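(* Let $W$ be an irreducible Weyl group of rank $\ell$ with Weyl arrangement $\mathscr{A}=\mathscr{A}(W)$ in $V=\mathbb{R}^\ell$, let $\exp(\mathscr{A})=(e_1\le e_2\le\dots\le e_\ell)$, and let $H\in\mathscr{A}$ be the hyperplane corresponding to the highest root of an irreducible root system associated to $W$. Then $\mathscr{A}^H$ is free with $\exp(\mathscr{A}^H)=(e_1\le e_2\le\dots\le e_{\ell-1})$.
   Context: For an irreducible Weyl group $W$ acting on $V=\mathbb{R}^\ell$ with (reduced, crystallographic, irreducible, spanning) root system $\Phi\subseteq V^*$ and positive system $\Phi^+$, the Weyl arrangement is $\mathscr{A}(W)=\{\ker\beta\mid\beta\in\Phi^+\}$; a root $\beta$ corresponds to the hyperplane $\ker\beta$. The restriction of an arrangement $\mathscr{A}$ to $H\in\mathscr{A}$ is the arrangement $\mathscr{A}^H=\{H'\cap H\mid H'\in\mathscr{A}\setminus\{H\}\}$ in $H$. For an arrangement $\mathscr{A}$ (finite set of linear hyperplanes) in $V\cong\mathbb{K}^\ell$ let $S=\mathrm{Sym}(V^* )\cong\mathbb{K}[x_1,\dots,x_\ell]$ and $H=\ker\alpha_H$ for $H\in\mathscr{A}$. $D(\mathscr{A})=\{\theta\in\mathrm{Der}_{\mathbb{K}}(S)\mid\theta(\alpha_H)\in\alpha_HS\text{ for all }H\in\mathscr{A}\}$. $\theta=\sum f_i\,\partial/\partial x_i$ is homogeneous of degree $p$ if all $f_i$ are homogeneous of degree $p$ (or zero). $\mathscr{A}$ is free if $D(\mathscr{A})$ is a free $S$-module;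 its exponents $\exp(\mathscr{A})$ are the degrees of a homogeneous basis of $D(\mathscr{A})$. Every Weyl arrangement is free. *)

(* Defs.v *)
From HB Require Import structures.
From mathcomp Require Import all_boot all_order all_algebra.
From mathcomp Require Import finmap mpoly reals.

Set Implicit Arguments.
Unset Strict Implicit.
Unset Printing Implicit Defensive.

Import Order.TTheory GRing.Theory Num.Theory.
Local Open Scope fset_scope.
Local Open Scope ring_scope.

Notation dual V := 'Hom(V, _^o).

Section Arrangements.
Variables (K : fieldType) (V : vectType K).
Implicit Types (A : {fset {vspace V}}) (H : {vspace V}) (alpha : dual V).

                                                                             
                                      
Definition symdual := {mpoly K[\dim {:V}]}.

Definition form_poly alpha : symdual :=
  \sum_(i < \dim {:V}) (alpha (vbasis {:V})`_i : K) *: 'X_i.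

Definition derivation (theta : symdual -> symdual) : Prop :=
  linear theta /\ forall f g, theta (f * g) = f * theta g + theta f * g.

                                                                                
                                                                     
Definition log_derivation A (theta : symdual -> symdual) : Prop :=
  derivation theta /\
  forall H alpha, H \in A -> lker alpha = H ->
    exists g, theta (form_poly alpha) = form_poly alpha * g.

                                                                               
Definition log_basis A r (theta : 'I_r -> symdual -> symdual) : Prop :=
  (forall i, log_derivation A (theta i)) /\
  forall delta, log_derivation A delta ->
    exists! g : {ffun 'I_r -> symdual},
      forall f, delta f = \sum_(i < r) g i * theta i f.

Definition free_arrangement A : Prop :=
  exists r (theta : 'I_r -> symdual -> symdual), log_basis A theta.

Definition homogeneous_derivation p (theta : symdual -> symdual) : Prop :=
  forall k : 'I_(\dim {:V}), theta 'X_k \is p.-homog.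

Definition exponents A (e : seq nat) : Prop :=
  sorted leq e /\
  exists theta : 'I_(size e) -> symdual -> symdual,
    log_basis A theta /\
    forall i : 'I_(size e), homogeneous_derivation (nth 0%N e i) (theta i).

                                                         
Definition trace_on H (H' : {vspace V}) : {vspace subvs_of H} :=
  (linfun (vsval : subvs_of H -> V) @^-1: H')%VS.

Definition restriction A H : {fset {vspace subvs_of H}} :=
  [fset trace_on H H' | H' in A `\ H].

End Arrangements.

Section RootSystems.
Variables (R : realType) (V : vectType R).
Implicit Types (Phi Phip : {fset dual V}) (alpha beta theta : dual V) (v : V).

                                                                              
                                                                              
Definition is_coroot Phi alpha v : Prop :=
  alpha v = 2 /\
  forall beta, beta \in Phi -> beta - (beta v : R) *: alpha \in Phi.

Definition root_system Phi : Prop :=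
  [/\ 0 \notin Phi, <<Phi>>%VS = fullv
    & forall alpha, alpha \in Phi -> exists v, is_coroot Phi alpha v].

Definition crystallographic Phi : Prop :=
  forall alpha beta v, alpha \in Phi -> beta \in Phi ->
    is_coroot Phi alpha v -> (beta v : R) \is a Num.int.

Definition reduced Phi : Prop :=
  forall alpha (c : R), alpha \in Phi -> c *: alpha \in Phi ->
    c = 1 \/ c = -1.

Definition irreducible Phi : Prop :=
  Phi != fset0 /\
  forall Psi, Psi `<=` Phi ->
    (forall alpha beta v, alpha \in Psi -> beta \in Phi `\` Psi ->
       is_coroot Phi alpha v -> beta v = 0) ->
    Psi = fset0 \/ Psi = Phi.

                                                                         
Definition positive_system Phi Phip : Prop :=
  exists v, (forall beta, beta \in Phi -> beta v != 0) /\
    Phip = [fset beta in Phi | (0 : R) < beta v].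

Definition root_le Phip alpha beta : Prop :=
  exists c : dual V -> nat, beta - alpha = \sum_(gamma <- Phip) gamma *+ c gamma.

Definition highest_root Phi Phip theta : Prop :=
  theta \in Phi /\ forall beta, beta \in Phi -> root_le Phip beta theta.

Definition weyl_arrangement Phip : {fset {vspace V}} :=
  [fset lker beta | beta in Phip].

End RootSystems.

(* Main.v *)
From HB Require Import structures.
Require Import Defs.
From mathcomp Require Import all_boot all_order all_algebra.
From mathcomp Require Import perm finmap mpoly boolp reals ring lra.

Set Implicit Arguments.
Unset Strict Implicit.
Unset Printing Implicit Defensive.

Import Order.TTheory GRing.Theory Num.Theory.
Local Open Scope fset_scope.
Local Open Scope ring_scope.

(** Let A_k be the hyperplanes of the positive roots of height at most k. One
    shows by induction on k that A_k is free with exponents at most k (multiple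
    addition). If b is a root of height k + 1, then for every theta in D(A_k)
    the restriction of theta(b) to ker b is divisible by a polynomial of degree
    |A_k| - |A_k^(ker b)|, and this degree is at least k: the height of b is
    one plus the sum of the local contributions (local height minus one) of
    the planes spanned by b and another root. The roots of height k + 1 are
    linearly independent, and their span contains no root of smaller height,
    so at a generic point of the intersection of their hyperplanes the basis
    fields of degree k are transverse to them; after a constant base change it
    suffices to multiply one such field by each new root (Saito's criterion).

    The highest root is alone in the top height m + 1. So D(A_m) has a basis of
    degrees d_i <= m in which all the fields but one, of degree m, are tangent
    to H; the exponents of A are those of A_m with this m replaced by m + 1,
    the maximum. The other l - 1 fields restrict to fields tangent to A^H, are
    independent at a generic point of H, and their degrees sum to
    |A_m| - m = |A^H|; Saito's criterion shows that they form a basis. *)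

(** * Polynomials on a vector space *)

(** Heights are measured by half the sum of the positive coroots, not by coordinates in a base. This
    functional is linear, equals 1 on simple roots because a simple reflection permutes the other
    positive roots, and makes sense with the same positive half in every subsystem. Sorting the
    coroots by the planes through b turns the height of b into local heights; applied to the roots
    whose height is divisible by a fixed one, it controls the span of a height level. For the degree
    |A_k| - |A_k^H| the roots only give a lower bound. Equality at the top comes from freeness: some
    field of degree m is not tangent to H, and its nonzero restriction is divisible by a polynomial
    of that degree. The exponents in the statement come with an arbitrary homogeneous basis, so they
    must be matched with the constructed degrees, by comparing the two bases. *)

Section FormPoly.
Variables (K : fieldType) (V : vectType K).
Local Notation n := (\dim {:V}).
Implicit Types (a b : 'Hom(V, K^o)) (x : V).

Lemma form_polyD a b : form_poly (a + b) = form_poly a + form_poly b.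
Proof.
rewrite /form_poly -big_split /=; apply: eq_bigr => i _.
by rewrite add_lfunE scalerDl.
Qed.

Lemma form_polyZ (c : K) a : form_poly (c *: a) = c *: form_poly a.
Proof.
rewrite /form_poly scaler_sumr; apply: eq_bigr => i _.
by rewrite scale_lfunE scalerA.
Qed.

Lemma form_poly0 : form_poly (0 : 'Hom(V, K^o)) = 0.
Proof. by rewrite /form_poly big1 // => i _; rewrite lfunE scale0r. Qed.

Definition evalv x (f : symdual V) : K :=
  f.@[fun i => coord (vbasis {:V}) i x].

HB.instance Definition _ x := GRing.LRMorphism.copy (evalv x)
  (meval (fun i => coord (vbasis {:V}) i x)).

Lemma evalvZ x (c : K) f : evalv x (c *: f) = c * evalv x f.
Proof. exact: mevalZ. Qed.

Lemma evalv_form x a : evalv x (form_poly a) = a x.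
Proof.
rewrite /form_poly linear_sum /=.
rewrite {2}(coord_vbasis (memvf x)) linear_sum /=.
apply: eq_bigr => i _; rewrite linearZ /= linearZ /=.
by rewrite /evalv mevalXU mulrC.
Qed.

Lemma form_poly_eq0 a : form_poly a = 0 -> a = 0.
Proof.
move=> a0; apply/lfunP => x.
by rewrite -evalv_form a0 raddf0 lfunE.
Qed.

Lemma form_poly_homog a : form_poly a \is 1.-homog.
Proof.
by apply: rpred_sum => i _; apply: rpredZ; rewrite dhomogX /= mdeg1.
Qed.

End FormPoly.

(** * Substitution along a linear map *)

Section Pullback.
Variables (K : fieldType).

Definition coordf (V : vectType K) (i : 'I_(\dim {:V})) : 'Hom(V, K^o) :=
  linfun (coord (vbasis {:V}) i : V -> K^o).

Definition pullback (V W : vectType K) (g : 'Hom(W, V)) (f : symdual V) :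
    symdual W :=
  f \mPo [tuple form_poly (coordf i \o g)%VF | i < \dim {:V}].

HB.instance Definition _ (V W : vectType K) (g : 'Hom(W, V)) :=
  GRing.RMorphism.copy (pullback g)
    (comp_mpoly [tuple form_poly (coordf i \o g)%VF | i < \dim {:V}]).

Variables (V W : vectType K) (g : 'Hom(W, V)).

Lemma pullbackX i : pullback g 'X_i = form_poly (coordf i \o g)%VF.
Proof. by rewrite /pullback comp_mpolyXU -tnth_nth tnth_mktuple. Qed.

Lemma pullbackZ c f : pullback g (c *: f) = c *: pullback g f.
Proof. exact: comp_mpolyZ. Qed.

Lemma pullback_form (a : 'Hom(V, K^o)) :
  pullback g (form_poly a) = form_poly (a \o g)%VF.
Proof.
rewrite {1}/form_poly rmorph_sum /=.
under eq_bigr do rewrite pullbackZ pullbackX -form_polyZ.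
rewrite -(big_morph _ (@form_polyD K W) (@form_poly0 K W)).
congr form_poly; apply/lfunP => w; rewrite sum_lfunE lfunE /=.
rewrite [in RHS](coord_vbasis (memvf (g w))) linear_sum /=.
apply: eq_bigr => i _; rewrite linearZ /= scale_lfunE lfunE /= lfunE /=.
exact: mulrC.
Qed.

Lemma evalv_pullback w f : evalv w (pullback g f) = evalv (g w) f.
Proof.
rewrite /evalv /pullback comp_mpoly_meval; apply: meval_eq => i.
by rewrite tnth_mktuple -/(evalv w _) evalv_form lfunE /= lfunE.
Qed.

Lemma dhomog_bigprod (I : Type) n (r : seq I) (P : pred I) (F : I -> {mpoly K[n]}) d :
  (forall i, P i -> F i \is (d i).-homog) ->
  \prod_(i <- r | P i) F i \is (\sum_(i <- r | P i) d i)%N.-homog.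
Proof.
move=> Fd; apply: (big_ind2 (fun p k => p \is k.-homog)) => //.
- exact: dhomog1.
- by move=> p k q m pk qm; apply: dhomogM.
Qed.

Lemma pullback_homog d f : f \is d.-homog -> pullback g f \is d.-homog.
Proof.
move=> /dhomogP fd; rewrite /pullback comp_mpolyEX big_seq.
apply: rpred_sum => m /fd md; apply: rpredZ.
have -> : d = (\sum_i m i)%N by rewrite -md /= mdegE.
rewrite comp_mpolyX; apply: dhomog_bigprod => i _.
rewrite tnth_mktuple -[d in d.-homog]mul1n; apply: dhomogMn.
exact: form_poly_homog.
Qed.

End Pullback.

(** * Divisibility and coprimality of polynomials *)

Section Divisibility.
Variables (K : fieldType) (n : nat).
Implicit Types (p q f g h : {mpoly K[n]}).

Definition mdvd p f := exists g, f = p * g.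

Lemma mdvd0 p : mdvd p 0. Proof. by exists 0; rewrite mulr0. Qed.

Lemma mdvdD p f g : mdvd p f -> mdvd p g -> mdvd p (f + g).
Proof. by move=> [u ->] [v ->]; exists (u + v); rewrite mulrDr. Qed.

Lemma mdvdMr p f g : mdvd p f -> mdvd p (g * f).
Proof. by move=> [u ->]; exists (g * u); rewrite mulrCA. Qed.

Lemma mdvdMl p f g : mdvd p f -> mdvd p (f * g).
Proof. by rewrite mulrC; apply: mdvdMr. Qed.

Lemma mdvdZ p f (c : K) : mdvd p f -> mdvd p (c *: f).
Proof. by rewrite -mul_mpolyC; apply: mdvdMr. Qed.

Lemma mdvdN p f : mdvd p f -> mdvd p (- f).
Proof. by rewrite -scaleN1r; apply: mdvdZ. Qed.

Lemma mdvdB p f g : mdvd p f -> mdvd p g -> mdvd p (f - g).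
Proof. by move=> pf pg; apply: mdvdD => //; apply: mdvdN. Qed.

(* Coprimality is taken in the form of Gauss's lemma, which avoids gcds. *)
Definition mcoprime p q := forall f, mdvd q (p * f) -> mdvd q f.

Lemma mcoprime1 q : mcoprime 1 q. Proof. by move=> f; rewrite mul1r. Qed.

Lemma mcoprimer1 p : mcoprime p 1. Proof. by move=> f _; exists f; rewrite mul1r. Qed.

Lemma mcoprimeMl p1 p2 q : mcoprime p1 q -> mcoprime p2 q -> mcoprime (p1 * p2) q.
Proof. by move=> c1 c2 f; rewrite -mulrA => /c1/c2. Qed.

Lemma mcoprimeMr p q1 q2 : q1 != 0 -> mcoprime p q1 -> mcoprime p q2 ->
  mcoprime p (q1 * q2).
Proof.
move=> q1n0 c1 c2 f [u pf].
have [|v fE] := c1 f; first by exists (q2 * u); rewrite mulrA.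
have [|w vE] := c2 v; last by exists w; rewrite fE vE mulrA.
exists u; apply: (mulfI q1n0); rewrite mulrCA -fE pf mulrA; done.
Qed.

Lemma mcoprime_prodl (I : eqType) (r : seq I) (P : pred I) F q :
  (forall i, i \in r -> P i -> mcoprime (F i) q) ->
  mcoprime (\prod_(i <- r | P i) F i) q.
Proof.
move=> cF; rewrite big_seq_cond; elim/big_ind: _ => [|p1 p2|i /andP[ir Pi]].
- exact: mcoprime1.
- exact: mcoprimeMl.
- exact: cF.
Qed.

Lemma mcoprime_prodr (I : eqType) (r : seq I) (P : pred I) F p :
  (forall i, i \in r -> P i -> F i != 0) ->
  (forall i, i \in r -> P i -> mcoprime p (F i)) ->
  mcoprime p (\prod_(i <- r | P i) F i).
Proof.
elim: r => [|i r IHr] Fn0 cF; first by rewrite big_nil; apply: mcoprimer1.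
have cr : mcoprime p (\prod_(j <- r | P j) F j).
  by apply: IHr => j jr; [apply: Fn0 | apply: cF]; rewrite inE jr orbT.
rewrite big_cons; case: ifP => // Pi.
by apply: mcoprimeMr => //; [apply: Fn0 | apply: cF]; rewrite ?inE ?eqxx.
Qed.

Lemma mdvd_prod (I : eqType) (r : seq I) (F : I -> {mpoly K[n]}) f :
  uniq r ->
  {in r &, forall i j, i != j -> mcoprime (F i) (F j)} ->
  {in r, forall i, mdvd (F i) f} -> mdvd (\prod_(i <- r) F i) f.
Proof.
elim: r f => [|i r IHr] f /=; first by exists f; rewrite big_nil mul1r.
move=> /andP[inr ur] cF Ff.
have [g fE] : mdvd (F i) f by apply: Ff; rewrite inE eqxx.
have [j k jr kr|j jr|h gE] := IHr g ur.
- by apply: (cF j k); rewrite inE ?jr ?kr orbT.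
- have jir : j \in i :: r by rewrite inE jr orbT.
  have ij : i != j by apply: contraNneq inr => ->.
  by apply: (cF i j (mem_head i r) jir ij); rewrite -fE; apply: Ff.
by exists h; rewrite big_cons fE gE mulrA.
Qed.

End Divisibility.

(** * Linear forms as prime elements *)

Section FormPrime.
Variables (K : fieldType) (V : vectType K).
Implicit Types (a b : 'Hom(V, K^o)) (p : V).

Definition line_map p (t : K^o) : V := (t : K) *: p.

Lemma line_map_is_linear p : linear (line_map p).
Proof. by move=> c s t; rewrite /line_map scalerDl scalerA. Qed.

HB.instance Definition _ p :=
  GRing.isLinear.Build K K^o V *:%R (line_map p) (line_map_is_linear p).

(* For [a p = 1] this is the projection onto [lker a] along [p], and the
   kernel of the induced substitution is the ideal generated by [a]. *)
Definition proj_along a p : 'End(V) := (\1 - (linfun (line_map p) \o a))%VF.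

Lemma proj_alongE a p v : proj_along a p v = v - (a v : K) *: p.
Proof.
by rewrite /proj_along add_lfunE opp_lfunE id_lfunE comp_lfunE lfunE.
Qed.

Lemma form_comp_proj a p b :
  (b \o proj_along a p)%VF = b - (b p : K) *: a.
Proof.
apply/lfunP => v; rewrite comp_lfunE proj_alongE add_lfunE opp_lfunE.
by rewrite scale_lfunE linearB linearZ /= [X in _ - X]mulrC.
Qed.

Lemma pullback_proj_form a p b :
  pullback (proj_along a p) (form_poly b) = form_poly (b - (b p : K) *: a).
Proof. by rewrite pullback_form form_comp_proj. Qed.

(** The projection changes each coordinate by a multiple of [a], and congruence modulo [a] is
    compatible with sums and products. *)
Lemma pullback_proj_mod a p f :
  mdvd (form_poly a) (f - pullback (proj_along a p) f).
Proof.
set P := pullback _; have P1 i : mdvd (form_poly a) ('X_i - P 'X_i).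
  rewrite /P pullbackX form_comp_proj.
  have -> : 'X_i = form_poly (coordf i).
    rewrite /form_poly (bigD1 i) //= big1 => [|j ji].
      rewrite addr0 lfunE /= coord_free ?eqxx ?scale1r //.
      exact: basis_free (vbasisP _).
    rewrite lfunE /= coord_free ?(basis_free (vbasisP _)) //.
    by rewrite (negPf ji) scale0r.
  exists (coordf i p : K)%:MP.
  by rewrite -scaleNr form_polyD form_polyZ opprD addrA subrr add0r scaleNr opprK mulrC mul_mpolyC.
have PM u v : mdvd (form_poly a) (u - P u) -> mdvd (form_poly a) (v - P v) ->
    mdvd (form_poly a) (u * v - P (u * v)).
  move=> du dv; have -> : u * v - P (u * v) = (u - P u) * v + P u * (v - P v).
    by rewrite /P rmorphM mulrBl mulrBr addrA subrK.
  by apply: mdvdD; [apply: mdvdMl | apply: mdvdMr].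
have P0 : mdvd (form_poly a) (1 - P 1) by rewrite /P rmorph1 subrr; apply: mdvd0.
elim/mpolyind: f => [|c m f _ _ IHf]; first by rewrite /P rmorph0 subrr; apply: mdvd0.
rewrite {1}/P rmorphD /= opprD addrACA; apply: mdvdD => //.
rewrite pullbackZ -scalerBr; apply: mdvdZ; rewrite -/P mpolyXE_id.
elim/big_ind: _ => // i _; elim: (m i) => [|k IHk]; first by rewrite expr0.
by rewrite exprS; apply: PM.
Qed.

Lemma pullback_proj_eq0 a p f : a p = 1 ->
  pullback (proj_along a p) f = 0 <-> mdvd (form_poly a) f.
Proof.
move=> ap; split=> [f0|[g ->]].
  by have := pullback_proj_mod a p f; rewrite f0 subr0.
rewrite rmorphM /= pullback_proj_form ap scale1r subrr.
by rewrite form_poly0 mul0r.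
Qed.

Lemma form_neq0_point a : a != 0 -> exists p, a p = 1.
Proof.
move=> an0; have [v av] : exists v, a v != 0.
  have : ~~ (fullv <= lker a)%VS.
    apply: contraNN an0 => /subvP k; apply/eqP/lfunP => v.
    by have := k v (memvf v); rewrite memv_ker lfunE => /eqP.
  by case/subvPn => v _; rewrite memv_ker => av; exists v.
by exists ((a v : K)^-1 *: v); rewrite linearZ /= [LHS]mulVf.
Qed.

(** The multiples of the form are the kernel of a ring map into an integral domain. *)
Lemma form_prime a : a != 0 -> forall f g,
  mdvd (form_poly a) (f * g) -> mdvd (form_poly a) f \/ mdvd (form_poly a) g.
Proof.
move=> /form_neq0_point[p ap] f g /(pullback_proj_eq0 _ ap); rewrite rmorphM /=.
by move/eqP; rewrite mulf_eq0 => /orP[] /eqP/(pullback_proj_eq0 _ ap); [left|right].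
Qed.

Lemma form_dvd_form a b : a != 0 -> mdvd (form_poly a) (form_poly b) ->
  exists t, b = t *: a.
Proof.
move=> /form_neq0_point[p ap] /(pullback_proj_eq0 _ ap).
rewrite pullback_proj_form => /form_poly_eq0/eqP.
by rewrite subr_eq0 => /eqP ->; exists (b p).
Qed.

Lemma form_coprime a b : b != 0 -> (forall t, a <> t *: b) ->
  mcoprime (form_poly a) (form_poly b).
Proof.
move=> bn0 ab f /(form_prime bn0)[/(form_dvd_form bn0)[t /ab]//|].
done.
Qed.

Lemma form_poly_neq0 a : a != 0 -> form_poly a != 0.
Proof. by apply: contraNneq => /form_poly_eq0 ->. Qed.

End FormPrime.

(** * Saito's criterion *)

Section HomogeneousDivision.
Variables (K : fieldType) (n : nat).
Implicit Types (p q u : {mpoly K[n]}).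

Lemma dhomog_msizeE d p : p != 0 -> p \is d.-homog -> msize p = d.+1.
Proof.
move=> pn0 pd; have := dhomog_uniq pn0 (dhomog_msize pd) pd.
by rewrite (mpolySpred _ pn0) /= => ->.
Qed.

Lemma dhomog_dvd_leq d e p q : p != 0 -> p \is d.-homog -> q \is e.-homog ->
  mdvd q p -> (e <= d)%N.
Proof.
move=> pn0 pd qe [u pE].
have /andP[qn0 un0] : (q != 0) && (u != 0) by rewrite -negb_or -mulf_eq0 -pE.
have := msizeM qn0 un0; rewrite -pE (dhomog_msizeE pn0 pd) (dhomog_msizeE qn0 qe).
by rewrite (mpolySpred _ un0) addSn addnS /= -addSn; move=> [->]; rewrite leq_addr.
Qed.

Lemma dhomog_dvd_eq d p q : p \is d.-homog -> q \is d.-homog ->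
  mdvd q p -> exists c, p = c *: q.
Proof.
move=> pd qd [u pE]; have [->|pn0] := eqVneq p 0; first by exists 0; rewrite scale0r.
have /andP[qn0 un0] : (q != 0) && (u != 0) by rewrite -negb_or -mulf_eq0 -pE.
have := msizeM qn0 un0; rewrite -pE (dhomog_msizeE pn0 pd) (dhomog_msizeE qn0 qd).
rewrite (mpolySpred _ un0) addSn addnS /= -[in LHS](addn0 d.+1) addSn => [[/addnI u0]].
have /eqP/msize_poly1P[c _ uE] : msize u = 1 by rewrite (mpolySpred _ un0) -u0.
by exists c; rewrite pE uE mulrC mul_mpolyC.
Qed.

Lemma det_homog m (M : 'M[{mpoly K[n]}]_m) (d : 'I_m -> nat) :
  (forall i j, M i j \is (d i).-homog) -> \det M \is (\sum_i d i).-homog.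
Proof.
move=> Md; apply: rpred_sum => s _.
by rewrite -signr_odd; case: odd; rewrite ?expr1 ?mulN1r ?rpredN ?expr0 ?mul1r dhomog_bigprod.
Qed.

End HomogeneousDivision.

Section Saito.
Variables (K : fieldType) (V : vectType K).
Local Notation n := (\dim {:V}).
Local Notation S := (symdual V).
Implicit Types (a b : 'Hom(V, K^o)) (F : seq 'Hom(V, K^o)) (th eta : 'rV[S]_n).

Definition vf th a : S := \sum_(i < n) (a (vbasis {:V})`_i : K) *: th 0 i.

Lemma vfD th a b : vf th (a + b) = vf th a + vf th b.
Proof.
by rewrite /vf -big_split; apply: eq_bigr => i _; rewrite add_lfunE scalerDl.
Qed.

Lemma vfZ th (c : K) a : vf th (c *: a) = c *: vf th a.
Proof.
by rewrite /vf scaler_sumr; apply: eq_bigr => i _; rewrite scale_lfunE scalerA.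
Qed.

Lemma vf_lincomb th I (r : seq I) (P : pred I) (t : I -> K) (F : I -> 'Hom(V, K^o)) :
  vf th (\sum_(i <- r | P i) t i *: F i) = \sum_(i <- r | P i) t i *: vf th (F i).
Proof.
elim/big_rec2: _ => [|i y z _ IH]; last by rewrite vfD vfZ IH.
by rewrite /vf big1 // => j _; rewrite lfunE scale0r.
Qed.

Lemma vfDl th eta a : vf (th + eta) a = vf th a + vf eta a.
Proof. by rewrite /vf -big_split; apply: eq_bigr => i _; rewrite mxE scalerDr. Qed.

Lemma vfZl (p : S) th a : vf (p *: th) a = p * vf th a.
Proof. by rewrite /vf mulr_sumr; apply: eq_bigr => i _; rewrite mxE -scalerAr. Qed.

Lemma vf_coordf th i : vf th (coordf i) = th 0 i.
Proof.
have fb := basis_free (vbasisP {:V}).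
rewrite /vf (bigD1 i) //= big1 => [|j ji].
  by rewrite addr0 lfunE /= coord_free // eqxx scale1r.
by rewrite lfunE /= coord_free // (negPf ji) scale0r.
Qed.

Lemma vf_homog d th a : (forall j, th 0 j \is d.-homog) -> vf th a \is d.-homog.
Proof. by move=> thd; apply: rpred_sum => i _; apply: rpredZ. Qed.

Definition logv F th := {in F, forall a, mdvd (form_poly a) (vf th a)}.

Definition nonparallel F :=
  [/\ uniq F, 0 \notin F & {in F &, forall a b (t : K), a = t *: b -> a = b}].

Lemma nonparallel_coprime F a b : nonparallel F -> a \in F -> b \in F -> a != b ->
  mcoprime (form_poly a) (form_poly b).
Proof.
move=> [_ F0 Fp] aF bF ab; apply: form_coprime.
  by apply: contraNneq F0 => <-.
by move=> t abt; move/eqP: ab; apply; apply: Fp abt.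
Qed.

Lemma vf_row_mul (M : 'M[S]_n) a i :
  vf (row i M) a = (M *m (\col_(j < n) (a (vbasis {:V})`_j : K)%:MP)) i 0.
Proof.
by rewrite /vf mxE; apply: eq_bigr => j _; rewrite !mxE mulrC mul_mpolyC.
Qed.

(* Modulo [a] the coefficient vector of [a] lies in the kernel of [M]. *)
Lemma logv_det_dvd F (M : 'M[S]_n) a : a \in F -> a != 0 ->
  (forall i, logv F (row i M)) -> mdvd (form_poly a) (\det M).
Proof.
move=> aF an0 ML; have [p ap] := form_neq0_point an0.
apply/(pullback_proj_eq0 _ ap); rewrite -det_map_mx.
set N := map_mx _ M.
pose w := \col_(j < n) (a (vbasis {:V})`_j : K)%:MP : 'cV[S]_n.
have Nw : N *m w = 0.
  have wE : w = map_mx (pullback (proj_along a p)) w.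
    by apply/matrixP => i j; rewrite !mxE /= /pullback comp_mpolyC.
  rewrite wE -map_mxM; apply/matrixP => i j; rewrite !mxE ord1.
  have := ML i a aF; rewrite vf_row_mul => /(pullback_proj_eq0 _ ap).
  by rewrite mxE.
have dw : \det N *: w = 0.
  by rewrite -mul_scalar_mx -mul_adj_mx -mulmxA Nw mulmx0.
have [j aj] : exists j : 'I_n, a (vbasis {:V})`_j != 0.
  apply/existsP; apply: contraNT an0; rewrite negb_exists => /forallP a0.
  apply/eqP/lfunP => v; rewrite (coord_vbasis (memvf v)) linear_sum lfunE /=.
  apply: big1 => j _; have := a0 j; rewrite negbK => /eqP aj.
  by rewrite linearZ /= aj scaler0.
have /eqP := congr1 (fun A : 'cV[S]_n => A j 0) dw.
rewrite !mxE mulf_eq0 => /orP[/eqP //|].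
by rewrite mpolyC_eq0 (negPf aj).
Qed.

Lemma logv_det_dvd_prod F (M : 'M[S]_n) : nonparallel F ->
  (forall i, logv F (row i M)) -> mdvd (\prod_(a <- F) form_poly a) (\det M).
Proof.
move=> Fn ML; have [uF F0 _] := Fn; apply: mdvd_prod => // [a b aF bF ab|a aF].
  exact: nonparallel_coprime Fn _ _ _.
by apply: logv_det_dvd ML => //; apply: contraNneq F0 => <-.
Qed.

Lemma prod_forms_homog F : \prod_(a <- F) form_poly a \is (size F).-homog.
Proof.
rewrite -sum1_size; apply: dhomog_bigprod => a _; exact: form_poly_homog.
Qed.

Variables (F : seq 'Hom(V, K^o)) (M : 'M[S]_n) (d : 'I_n -> nat).
Hypotheses (Fn : nonparallel F) (ML : forall i, logv F (row i M)).
Hypotheses (Md : forall i j, M i j \is (d i).-homog).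
Hypotheses (dF : (\sum_i d i)%N = size F) (Mn0 : \det M != 0).

(** The product divides the determinant, and both are homogeneous of degree [size F]; the quotient
    is therefore constant. *)
Lemma saito_det : exists2 c, c != 0 & \det M = c *: \prod_(a <- F) form_poly a.
Proof.
have [c cE] := dhomog_dvd_eq (det_homog Md)
  (etrans (congr1 (fun k => _ \is k.-homog) dF) (prod_forms_homog F))
  (logv_det_dvd_prod Fn ML).
by exists c => //; apply: contraNneq Mn0 => c0; rewrite cE c0 scale0r.
Qed.

Lemma det_neq0_inj (g h : 'rV[S]_n) : g *m M = h *m M -> g = h.
Proof.
move=> gh; apply/eqP; rewrite -subr_eq0; apply/eqP.
have : (g - h) *m M *m \adj M = 0 by rewrite mulmxBl gh subrr mul0mx.
rewrite -mulmxA mul_mx_adj mul_mx_scalar => gh0; apply/rowP => i.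
by have /eqP := congr1 (fun x : 'rV_n => x 0 i) gh0; rewrite !mxE mulf_eq0 (negPf Mn0) => /eqP.
Qed.

(** Cramer's rule: putting [eta] in place of row [k] leaves a matrix with logarithmic rows, so its
    determinant, an entry of [eta *m \adj M], is divisible by the product of the forms. By
    [saito_det] that product is [\det M] up to a constant, so the Cramer quotients are
    polynomials. *)
Lemma saito_span eta : logv F eta -> exists g : 'rV[S]_n, eta = g *m M.
Proof.
move=> etaL; have [c cn0 cE] := saito_det.
set Q := \prod_(a <- F) _ in cE.
have Mk k : mdvd Q (\det (\matrix_(i, j) (if i == k then eta 0 j else M i j))).
  apply: logv_det_dvd_prod => // i a aF.
  have [->|ik] := eqVneq i k.
    rewrite (_ : row k _ = eta); first exact: etaL.
    by apply/rowP => j; rewrite !mxE eqxx.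
  rewrite (_ : row i _ = row i M); first exact: ML.
  by apply/rowP => j; rewrite !mxE (negPf ik).
have Qe k : mdvd Q ((eta *m \adj M) 0 k).
  have := Mk k; rewrite (expand_det_row _ k).
  rewrite mxE; under eq_bigr => j _.
    rewrite mxE eqxx.
    have -> : cofactor (\matrix_(i, j) (if i == k then eta 0 j else M i j)) k j =
              (\adj M) j k.
      rewrite [RHS]mxE /cofactor; congr (_ * \det _).
      apply/matrixP => i l; rewrite !mxE.
      by rewrite eq_sym (negPf (neq_lift k i)).
    over.
  done.
have [g gE] : exists g : 'rV[S]_n, eta *m \adj M = Q *: g.
  have /fin_all_exists[g gE] : forall k, exists h, (eta *m \adj M) 0 k = Q * h.
    by move=> k; exact: Qe.
  by exists (\row_k g k); apply/rowP => k; rewrite gE !mxE.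
exists (c^-1%:MP *: g).
have Qn0 : Q != 0 by apply: contraNneq Mn0 => Q0; rewrite cE Q0 scaler0.
have QE : (Q *: (c%:MP *: eta)) = Q *: (g *m M).
  rewrite scalemxAl -gE -mulmxA mul_adj_mx mul_mx_scalar cE.
  by rewrite scalerA -mul_mpolyC mulrC.
have -> : eta = c^-1%:MP *: (c%:MP *: eta).
  by rewrite scalerA -mpolyCM mulVf // scale1r.
rewrite -scalemxAl; congr (_ *: _).
apply/rowP => j; apply: (mulfI Qn0).
by have := congr1 (fun x : 'rV_n => x 0 j) QE; rewrite !mxE.
Qed.

End Saito.

(** * Logarithmic derivations and exponents *)

Section Derivations.
Variables (K : fieldType) (V : vectType K).
Local Notation n := (\dim {:V}).
Local Notation S := (symdual V).
Implicit Types (a b : 'Hom(V, K^o)) (F : seq 'Hom(V, K^o)) (th eta : 'rV[S]_n).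
Implicit Types (A : {fset {vspace V}}) (delta : S -> S).

Definition der th (f : S) : S := \sum_i th 0 i * f^`M(i).

Lemma der_derivation th : derivation (der th).
Proof.
split=> [c f g|f g]; rewrite /der.
  rewrite scaler_sumr -big_split; apply: eq_bigr => i _ /=.
  by rewrite linearP mulrDr -scalerAr.
rewrite mulr_sumr mulr_suml -big_split; apply: eq_bigr => i _ /=.
by rewrite mderivM mulrDr [RHS]addrC [in RHS]mulrCA !mulrA.
Qed.

Lemma derX th i : der th 'X_i = th 0 i.
Proof.
rewrite /der (bigD1 i) //= big1 => [|j ji].
  rewrite addr0 mderivX mnm1E eqxx scale1r.
  by rewrite -[X in (X - _)%MM]add0m addmK mpolyX0 mulr1.
by rewrite mderivX mnm1E eq_sym (negPf ji) scale0r mulr0.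
Qed.

Lemma derivation_form delta a : derivation delta ->
  delta (form_poly a) = vf (\row_i delta 'X_i) a.
Proof.
move=> [dl _]; rewrite /form_poly /vf.
have d0 : delta 0 = 0.
  by have := dl (-1) 0 0; rewrite scaler0 addr0 scaleN1r addNr.
have dD : {morph delta : f g / f + g}.
  by move=> f g; have := dl 1 f g; rewrite !scale1r.
rewrite (big_morph _ dD d0); apply: eq_bigr => i _; rewrite mxE.
by have := dl (a (vbasis {:V})`_i) 'X_i 0; rewrite d0 !addr0.
Qed.

Lemma derivation_der delta : derivation delta ->
  delta =1 der (\row_i delta 'X_i).
Proof.
move=> dd; have [dl dM] := dd; set th := \row_i _.
have [el eM] := der_derivation th.
have d0 : delta 0 = 0.
  by have := dl (-1) 0 0; rewrite scaler0 addr0 scaleN1r addNr.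
have e0 : der th 0 = 0.
  by have := el (-1) 0 0; rewrite scaler0 addr0 scaleN1r addNr.
have d1 : delta 1 = 0.
  by have /eqP := dM 1 1; rewrite !mul1r mulr1 eq_sym -subr_eq0 addrK => /eqP.
have e1 : der th 1 = 0.
  by have /eqP := eM 1 1; rewrite !mul1r mulr1 eq_sym -subr_eq0 addrK => /eqP.
elim/mpolyind => [|c m p _ _ IHp]; first by rewrite d0 e0.
rewrite dl el IHp; congr (c *: _ + _); rewrite mpolyXE_id.
elim/big_ind: _ => [|f g df dg|i _]; first by rewrite d1 e1.
  by rewrite dM eM df dg.
elim: (m i) => [|k IHk]; first by rewrite expr0 d1 e1.
by rewrite exprS dM eM IHk derX mxE.
Qed.

(** Logarithmic derivations are tested on every form whose kernel lies in [A]. Chosen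
    representatives suffice, since forms with the same kernel are proportional. *)
Definition represents A F :=
  (forall H, H \in A -> exists2 a, a \in F & lker a = H) /\
  (forall a, a \in F -> lker a \in A).

Lemma lker_sub_scale a b : (lker a <= lker b)%VS -> exists t : K, b = t *: a.
Proof.
move=> ab; have [a0|/form_neq0_point[p ap]] := eqVneq a 0.
  exists 0; rewrite scale0r; apply/lfunP => v; rewrite lfunE /=.
  apply/eqP; rewrite -memv_ker; apply: (subvP ab).
  by rewrite memv_ker a0 lfunE.
exists (b p); apply/lfunP => v; rewrite scale_lfunE.
have /(subvP ab) : v - (a v : K) *: p \in lker a.
  by rewrite memv_ker linearB linearZ /= ap [X in _ - X]mulr1 subrr.
by rewrite memv_ker linearB linearZ /= subr_eq0 => /eqP ->; rewrite [LHS]mulrC.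
Qed.

Lemma log_derivationP A F delta : represents A F -> derivation delta ->
  log_derivation A delta <-> logv F (\row_i delta 'X_i).
Proof.
move=> [AF FA] dd; split=> [[_ dL] a aF|dL].
  have [g gE] := dL _ a (FA a aF) erefl.
  by exists g; rewrite -derivation_form.
split=> // H b HA bH; have [a aF aH] := AF H HA.
have [t ->] : exists t, b = t *: a by apply: lker_sub_scale; rewrite aH bH.
have [g gE] := dL a aF; exists g.
by rewrite derivation_form // vfZ gE form_polyZ scalerAl.
Qed.

Lemma log_der A F th : represents A F ->
  log_derivation A (der th) <-> logv F th.
Proof.
move=> AF; rewrite (log_derivationP AF (der_derivation th)).
by rewrite (_ : \row_i _ = th) //; apply/rowP => i; rewrite mxE derX.
Qed.

(** Independence is tested by the rank at one point. Unlike a determinant, this makes sense when the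
    number [r] of fields equals the dimension only propositionally. *)
Definition evmx x r (th : 'I_r -> 'rV[S]_n) : 'M[K]_(r, n) :=
  \matrix_(i, j) evalv x (th i 0 j).

Variables (A : {fset {vspace V}}) (F : seq 'Hom(V, K^o)).
Hypotheses (AF : represents A F) (Fn : nonparallel F).

Section Basis.
Variables (r : nat) (th : 'I_r -> 'rV[S]_n) (d : 'I_r -> nat).
Hypotheses (rn : r = n) (thL : forall i, logv F (th i)).
Hypotheses (thd : forall i j, th i 0 j \is (d i).-homog).
Hypotheses (dF : (\sum_i d i)%N = size F).
Hypotheses (x : V) (th_free : row_free (evmx x th)).

Lemma saito_basis eta : logv F eta ->
  exists! g : {ffun 'I_r -> S}, eta = \sum_i g i *: th i.
Proof.
move: th d thL thd dF th_free; rewrite rn.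
move=> th' d' thL' thd' dF' th_free' etaL.
pose M := \matrix_i th' i.
have rowM i : row i M = th' i by rewrite rowK.
have Mn0 : \det M != 0.
  apply: contraTneq th_free' => M0; rewrite row_free_unit unitmxE.
  have -> : evmx x th' = map_mx (evalv x) M by apply/matrixP => i j; rewrite !mxE.
  by rewrite det_map_mx M0 rmorph0 unitr0.
have ML i : logv F (row i M) by rewrite rowM.
have Md i j : M i j \is (d' i).-homog by rewrite mxE.
have [g gE] := saito_span Fn ML Md dF' Mn0 etaL.
have sumE (h : 'rV[S]_n) : h *m M = \sum_i h 0 i *: th' i.
  by rewrite mulmx_sum_row; apply: eq_bigr => i _; rewrite rowM.
exists [ffun i => g 0 i]; split.
  by rewrite gE sumE; apply: eq_bigr => i _; rewrite ffunE.
move=> h hE; have : g = \row_i h i.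
  apply: (det_neq0_inj Mn0); rewrite -gE hE sumE.
  by apply: eq_bigr => i _; rewrite mxE.
by move=> ->; apply/ffunP => i; rewrite ffunE mxE.
Qed.

Lemma saito_log_basis : log_basis A (fun i => der (th i)).
Proof.
split=> [i|delta dL]; first exact/(log_der _ AF).
have [dd _] := dL; have /(log_derivationP AF dd) etaL := dL.
have [g [gE gu]] := saito_basis etaL.
have sumE (h : {ffun 'I_r -> S}) f :
    der (\sum_i h i *: th i) f = \sum_i h i * der (th i) f.
  rewrite /der; under eq_bigr do rewrite summxE mulr_suml.
  rewrite exchange_big /=; apply: eq_bigr => i _; rewrite mulr_sumr.
  by apply: eq_bigr => j _; rewrite mxE mulrA.
exists g; split=> [f|h hE]; first by rewrite derivation_der // gE sumE.
apply: gu; apply/rowP => j; rewrite mxE hE -sumE derX.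
done.
Qed.

(** The transition matrices are mutually inverse, so a nonzero term in the expansion of [\det G]
    provides the permutation [s]. It satisfies [d (s i) <= e i] for each [i], while the sum of [e]
    is at most the sum of [d] because [\det P] divides [\det M]. *)
Lemma exponents_unique (phi : 'I_r -> S -> S) (e : 'I_r -> nat) :
  log_basis A phi -> (forall i, homogeneous_derivation (e i) (phi i)) ->
  exists2 s : 'I_r -> 'I_r, injective s & forall i, e i = d (s i).
Proof.
move: phi e; move: th d thL thd dF th_free; rewrite rn.
move=> th' d' thL' thd' dF' th_free' phi e [phiL phi_span] phie.
pose M := \matrix_i th' i.
have rowM i : row i M = th' i by rewrite rowK.
have Mn0 : \det M != 0.
  apply: contraTneq th_free' => M0; rewrite row_free_unit unitmxE.
  have -> : evmx x th' = map_mx (evalv x) M by apply/matrixP => i j; rewrite !mxE.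
  by rewrite det_map_mx M0 rmorph0 unitr0.
have ML i : logv F (row i M) by rewrite rowM.
have Md i j : M i j \is (d' i).-homog by rewrite mxE.
pose P := \matrix_(i, j) phi i 'X_j.
have Pe i j : P i j \is (e i).-homog by rewrite mxE; apply: phie.
have /fin_all_exists[g gE] i : exists g : 'rV[S]_n, row i P = g *m M.
  apply: (saito_span Fn ML Md dF' Mn0).
  have [dd _] := phiL i; have /(log_derivationP AF dd) := phiL i.
  by rewrite (_ : (\row_j phi i _) = row i P) //; apply/rowP => j; rewrite !mxE.
pose G := \matrix_i g i.
have PE : P = G *m M.
  by apply/row_matrixP => i; rewrite row_mul rowK gE.
have /fin_all_exists[h hE] i : exists h : 'rV[S]_n, th' i = h *m P.
  have /phi_span[h [hE _]] : log_derivation A (der (th' i)).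
    by apply/(log_der _ AF).
  exists (\row_j h j); apply/rowP => j; rewrite -derX hE mxE.
  by apply: eq_bigr => k _; rewrite !mxE.
pose Hm := \matrix_i h i.
have ME : M = Hm *m P.
  by apply/row_matrixP => i; rewrite row_mul !rowK hE.
have HG : Hm *m G = 1%:M.
  apply/row_matrixP => i; apply: (det_neq0_inj Mn0).
  by rewrite -!row_mul -mulmxA -PE -ME mul1mx.
have detHG : \det Hm * \det G = 1 by rewrite -det_mulmx HG det1.
have Gn0 : \det G != 0 by apply: contra_eq_neq detHG => ->; rewrite mulr0 eq_sym oner_eq0.
have sum_le : (\sum_i e i <= \sum_i d' i)%N.
  apply: (dhomog_dvd_leq Mn0 (det_homog Md) (det_homog Pe)).
  by exists (\det Hm); rewrite mulrC -det_mulmx -ME.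
have [s sG] : exists s : {perm 'I_n}, \prod_i G i (s i) != 0.
  apply/existsP; apply: contraNT Gn0; rewrite negb_exists => /forallP G0.
  apply/eqP; apply: big1 => s _; have := G0 s; rewrite negbK => /eqP ->.
  by rewrite mulr0.
have Gds i : (d' (s i) <= e i)%N.
  have Gi : G i (s i) != 0.
    by apply: contraNneq sG => Gi0; rewrite (bigD1 i) //= Gi0 mul0r.
  pose N := \matrix_(k, j) (if k == s i then P i j else M k j).
  have detN : \det N = G i (s i) * \det M.
    have -> : \det N = (P *m \adj M) i (s i).
      rewrite (expand_det_row _ (s i)) mxE; apply: eq_bigr => j _.
      rewrite mxE eqxx mxE [in RHS]mxE /cofactor; congr (_ * (_ * \det _)).
      by apply/matrixP => k l; rewrite !mxE eq_sym (negPf (neq_lift (s i) k)).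
    by rewrite PE -mulmxA mul_mx_adj mul_mx_scalar mxE mulrC.
  have Nd : \det N \is (\sum_k (if k == s i then e i else d' k)).-homog.
    by apply: det_homog => k j; rewrite mxE; case: eqP.
  have Nn0 : \det N != 0 by rewrite detN mulf_neq0.
  have := dhomog_dvd_leq Nn0 Nd (det_homog Md).
  rewrite (bigD1 (s i)) //= [X in (_ <= X)%N](bigD1 (s i)) //= eqxx.
  rewrite [X in (_ <= _ + X)%N](eq_bigr d') => [|k /negPf -> //].
  by rewrite leq_add2r; apply; exists (G i (s i)); rewrite detN mulrC.
exists s; first exact: perm_inj.
have sum_eq : (\sum_i d' (s i) = \sum_i e i)%N.
  apply/eqP; rewrite eqn_leq leq_sum => [|i _]; last exact: Gds.
  by rewrite (leq_trans sum_le) // (reindex_inj (@perm_inj _ s)).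
move=> i; apply/eqP; rewrite eqn_leq Gds andbT -subn_eq0.
have : (\sum_i (e i - d' (s i)) == 0)%N.
  by rewrite sumnB ?sum_eq ?subnn.
by rewrite sum_nat_eq0 => /forallP/(_ i).
Qed.

End Basis.
End Derivations.

(** * Root systems and heights *)

Lemma big_by_class (R : Type) (idx : R) (op : Monoid.com_law idx)
    (I J : eqType) (A : seq I) (B : seq J) (r : I -> J) (P : pred I) (F : I -> R) :
  uniq B -> {in A, forall i, P i -> r i \in B} ->
  \big[op/idx]_(i <- A | P i) F i =
  \big[op/idx]_(j <- B) \big[op/idx]_(i <- A | P i && (r i == j)) F i.
Proof.
move=> uB rB; under [RHS]eq_bigr do rewrite big_mkcondr /=.
rewrite exchange_big /= big_seq_cond [RHS]big_seq_cond.
apply: eq_bigr => i /andP[iA Pi]; rewrite (bigD1_seq (r i)) ?rB //= eqxx.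
by rewrite big1 ?Monoid.mulm1 // => j ji; rewrite eq_sym (negPf ji).
Qed.

Section RootSets.
Variables (R : realType) (E : vectType R) (dot : E -> E -> R).
Implicit Types (a b c d x y : E) (h : E -> R) (X : seq E) (Phi : {fset E}).
Hypothesis dotC : forall x y, dot x y = dot y x.
Hypothesis dotP : forall (t : R) x y z, dot (t *: x + y) z = t * dot x z + dot y z.
Hypothesis dot_gt0 : forall x, x != 0 -> 0 < dot x x.

Definition functional h := forall (t : R) x y, h (t *: x + y) = t * h x + h y.

Lemma functional0 h : functional h -> h 0 = 0.
Proof. by move=> hl; have := hl (-1) 0 0; rewrite scaler0 addr0 mulN1r addNr. Qed.

Lemma functionalD h x y : functional h -> h (x + y) = h x + h y.
Proof. by move=> hl; rewrite -[x]scale1r hl mul1r scale1r. Qed.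

Lemma functionalZ h t x : functional h -> h (t *: x) = t * h x.
Proof. by move=> hl; rewrite -[t *: x]addr0 hl functional0 // addr0. Qed.

Lemma functionalN h x : functional h -> h (- x) = - h x.
Proof. by move=> hl; rewrite -scaleN1r functionalZ // mulN1r. Qed.

Lemma functionalB h x y : functional h -> h (x - y) = h x - h y.
Proof. by move=> hl; rewrite functionalD // functionalN. Qed.

Lemma functional_sum h I (r : seq I) (P : pred I) F : functional h ->
  h (\sum_(i <- r | P i) F i) = \sum_(i <- r | P i) h (F i).
Proof.
move=> hl; apply: big_morph; last exact: functional0.
by move=> x y; apply: functionalD.
Qed.

Lemma functional_span h X : functional h -> {in X, forall x, h x = 0} ->
  {in <<X>>%VS, forall x, h x = 0}.
Proof.
move=> hl h0 x xX; rewrite (@coord_span _ _ _ (in_tuple X) x xX) functional_sum //.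
by apply: big1 => i _; rewrite functionalZ // h0 ?mulr0 // mem_nth.
Qed.

Lemma dotr_functional y : functional (dot^~ y).
Proof. by move=> t x z; apply: dotP. Qed.

Lemma dotl_functional x : functional (dot x).
Proof. by move=> t y z; rewrite dotC dotP !(dotC x). Qed.

Local Hint Resolve dotr_functional dotl_functional : core.

Lemma dot_eq0 x : dot x x <= 0 -> x = 0.
Proof. by move=> xx; apply: contraTeq xx => /dot_gt0; rewrite ltNge. Qed.

(** Move the negative coefficients of a relation to the other side: both sides are the same vector
    [y], and its product with itself is at most 0 by obtuseness, so [y] is 0. Since [h] is positive
    on [X], no positive coefficient can occur; the negated relation excludes negative ones. *)
Lemma obtuse_free h X : functional h -> uniq X -> {in X, forall x, 0 < h x} ->
  {in X &, forall x y, x != y -> dot x y <= 0} -> free X.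
Proof.
move=> hl uX hX oX; apply/(freeP (X := in_tuple X)) => k k0.
have key (e : 'I_(size X) -> R) : \sum_i e i *: X`_i = 0 -> forall i, e i <= 0.
  move=> e0 i; rewrite leNgt; apply/negP => ei.
  pose y := \sum_(j | 0 < e j) e j *: X`_j.
  pose z := \sum_(j | ~~ (0 < e j)) (- e j) *: X`_j.
  have yz : y = z.
    have /eqP := e0; rewrite (bigID (fun j => 0 < e j)) /= -/y addr_eq0 => /eqP ->.
    by rewrite /z -sumrN; apply: eq_bigr => j _; rewrite scaleNr.
  have y0 : y = 0.
    apply: dot_eq0; rewrite [X in dot _ X]yz functional_sum //.
    apply: sumr_le0 => j; rewrite -leNgt => ej.
    rewrite functionalZ // (functional_sum _ _ _ (dotr_functional _)) mulr_sumr.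
    apply: sumr_le0 => l el; rewrite (functionalZ _ _ (dotr_functional _)).
    rewrite mulr_ge0_le0 ?oppr_ge0 // mulr_ge0_le0 ?(ltW el) //.
    apply: oX; rewrite ?mem_nth // nth_uniq //.
    by apply: contraTneq el => /val_inj ->; rewrite -leNgt.
  have hy : 0 < h y.
    rewrite functional_sum // (bigD1 i) //= ltr_wpDr //.
      apply: sumr_ge0 => j /andP[ej _]; rewrite functionalZ // mulr_ge0 ?ltW //.
      by apply: hX; rewrite mem_nth.
    by rewrite functionalZ // mulr_gt0 // hX ?mem_nth.
  by move: hy; rewrite y0 functional0 ?ltxx.
move=> i; apply/eqP; rewrite eq_le key //= -oppr_le0.
apply: (key (fun j => - k j)); rewrite -[RHS]oppr0 -[in RHS]k0 -sumrN.
by apply: eq_bigr => j _; rewrite scaleNr.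
Qed.

Lemma free_coef0 X (e : E -> R) : free X -> \sum_(x <- X) e x *: x = 0 ->
  {in X, forall x, e x = 0}.
Proof.
move=> fX; rewrite (big_nth 0) big_mkord => e0 x xX.
have := elimT (freeP (X := in_tuple X)) fX (fun i => e X`_i) e0.
have iX : (index x X < size X)%N by rewrite index_mem.
by move=> /(_ (Ordinal iX)) /=; rewrite nth_index.
Qed.

Definition pair b a := 2 * dot b a / dot a a.

Definition refl a b := b - pair b a *: a.

Lemma pair_functional a : functional (pair^~ a).
Proof. by move=> t x y; rewrite /pair dotP; ring. Qed.

Lemma pair_self a : a != 0 -> pair a a = 2.
Proof. by move=> /dot_gt0 aa; rewrite /pair mulfK // gt_eqF. Qed.

Lemma dot_refl a x y : a != 0 -> dot (refl a x) (refl a y) = dot x y.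
Proof.
move=> /dot_gt0/lt0r_neq0 aa; rewrite /refl functionalB // !(functionalB _ _ (dotr_functional _)).
rewrite !functionalZ // !(functionalZ _ _ (dotr_functional _)) (dotC a y) /pair.
by field.
Qed.

Lemma refl_self a : a != 0 -> refl a a = - a.
Proof. by move=> a0; rewrite /refl pair_self // scaler_nat mulr2n opprD addrA subrr sub0r. Qed.

Lemma reflK a : a != 0 -> involutive (refl a).
Proof.
move=> a0 x; rewrite {1}/refl (functionalB _ _ (pair_functional a)).
rewrite (functionalZ _ _ (pair_functional a)).
rewrite pair_self // /refl -addrA -opprD -scalerDl.
by rewrite [X in X *: _](_ : _ = 0) ?scale0r ?subr0 //; ring.
Qed.

(** A reduced crystallographic root system without the spanning condition, so that the roots in a
    plane, or those satisfying a congruence on heights, are again an instance. *)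
Definition rootset Phi :=
  [/\ 0 \notin Phi,
      {in Phi &, forall a b, refl a b \in Phi},
      {in Phi &, forall a b, pair b a \is a Num.int}
    & {in Phi, forall a (t : R), t *: a \in Phi -> t = 1 \/ t = -1}].

Definition simple Phi h d :=
  [&& d \in Phi, 0 < h d &
      ~~ has (fun a => [&& 0 < h a, d - a \in Phi & 0 < h (d - a)]) Phi].

(* Pairing with the sum of the coroots that are positive for [h]. *)
Definition twice_height Phi h x := \sum_(a <- Phi | 0 < h a) pair x a.

Lemma twice_height_functional Phi h : functional (twice_height Phi h).
Proof.
move=> t x y; rewrite /twice_height mulr_sumr -big_split /=.
by apply: eq_bigr => a _; rewrite pair_functional.
Qed.

Lemma rootset_sub Phi (P : pred E) : rootset Phi ->
  {in Phi &, forall a b, P a -> P b -> P (refl a b)} ->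
  rootset [fset a in Phi | P a].
Proof.
move=> [P0 Pr Pi Pd] Psub; split.
- by rewrite !inE /= (negPf P0).
- move=> a b; rewrite !inE /= => /andP[aP Pa] /andP[bP Pb].
  by rewrite Pr // Psub.
- by move=> a b; rewrite !inE /= => /andP[aP _] /andP[bP _]; apply: Pi.
- by move=> a; rewrite !inE /= => /andP[aP _] t; rewrite !inE => /andP[taP _]; apply: Pd taP.
Qed.

(** * Simple roots and the half sum of positive coroots *)

Section Theory.
Variables (Phi : {fset E}) (h : E -> R).
Hypotheses (PhiR : rootset Phi) (hl : functional h).
Hypothesis hn0 : {in Phi, forall a, h a != 0}.

Let Phi0 a : a \in Phi -> a != 0.
Proof. by have [P0 _ _ _] := PhiR => aP; apply: contraNneq P0 => <-. Qed.

Lemma root_opp a : a \in Phi -> - a \in Phi.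
Proof. by move=> aP; have [_ Pr _ _] := PhiR; rewrite -refl_self ?Phi0 // Pr. Qed.

Lemma int_gt0 (t : R) : t \is a Num.int -> 0 < t -> 1 <= t.
Proof. by move=> /intrP[m ->]; rewrite ltr0z ler1z. Qed.

Lemma int_ge2 (t : R) : t \is a Num.int -> 0 < t -> t != 1 -> 2 <= t.
Proof.
move=> /intrP[m ->]; rewrite ltr0z -[1]/(1%:~R) eqr_int => m0 m1.
by rewrite -[2]/(2%:~R) ler_int; move: m m0 m1 => [[|[|m]]|m].
Qed.

(** If one of the two pairings is 1, a reflection produces the difference up to sign. Otherwise both
    integers are at least 2, and then [a - b] has squared length at most 0. *)
Lemma root_sub a b : a \in Phi -> b \in Phi -> a != b -> 0 < dot a b -> a - b \in Phi.
Proof.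
move=> aP bP ab dab; have [_ Pr Pi _] := PhiR.
have aa := dot_gt0 (Phi0 aP); have bb := dot_gt0 (Phi0 bP).
have dba : 0 < dot b a by rewrite dotC.
have [p1|p1] := eqVneq (pair a b) 1.
  by have := Pr b a bP aP; rewrite /refl p1 scale1r.
have [q1|q1] := eqVneq (pair b a) 1.
  by rewrite -opprB root_opp //; have := Pr a b aP bP; rewrite /refl q1 scale1r.
have := int_ge2 (Pi b a bP aP); rewrite p1 => /(_ _ isT).
rewrite /pair ler_pdivlMr // divr_gt0 ?mulr_gt0 // => /(_ isT) pab.
have := int_ge2 (Pi a b aP bP); rewrite q1 => /(_ _ isT).
rewrite /pair ler_pdivlMr // divr_gt0 ?mulr_gt0 // => /(_ isT) qab.
case/eqP: ab; apply/eqP; rewrite -subr_eq0; apply/eqP/dot_eq0.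
rewrite functionalB // !(functionalB _ _ (dotr_functional _)) (dotC b a) in qab *.
lra.
Qed.

(** Otherwise the difference would be a root of height 0. *)
Lemma same_height_obtuse a b : a \in Phi -> b \in Phi -> a != b -> h a = h b ->
  dot a b <= 0.
Proof.
move=> aP bP ab hab; rewrite leNgt; apply/negP => /(root_sub aP bP ab) /hn0.
by rewrite functionalB // hab subrr eqxx.
Qed.

Lemma simple_decomposition a : a \in Phi -> 0 < h a ->
  exists e : E -> nat, a = \sum_(d <- Phi | simple Phi h d) d *+ e d.
Proof.
(* The values of [h] are only real numbers here, so the induction runs on the number of roots with a
   smaller value. *)
have [m] := ubnP (count (fun b => h b < h a) Phi).
elim: m a => // m IHm a; rewrite ltnS => am aP ha.
have [sa|sa] := boolP (simple Phi h a).
  exists (fun d => (d == a)%N); rewrite -big_filter (bigD1_seq a) /=.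
  - rewrite eqxx mulr1n big1 ?addr0 // => d /negPf ->.
    by rewrite mulr0n.
  - by rewrite mem_filter sa.
  - by rewrite filter_uniq // fset_uniq.
move: sa; rewrite /simple aP ha /= negbK => /hasP[b bP /and3P[hb abP hab]].
have lt_count c : h c < h a -> c \in Phi -> (count (fun b => h b < h c)%R Phi < m)%N.
  move=> hca cP; apply: leq_trans am.
  rewrite -!size_filter; apply: (@leq_trans (size (c :: [seq x <- Phi | h x < h c]))) => //.
  apply: uniq_leq_size.
    by rewrite /= filter_uniq ?fset_uniq // mem_filter ltxx.
  move=> x; rewrite inE !mem_filter => /orP[/eqP ->|/andP[hx ->]]; first by rewrite hca.
  by rewrite (lt_trans hx hca).
have hba : h b < h a by move: hab; rewrite functionalB // subr_gt0.
have haba : h (a - b) < h a by rewrite functionalB // gtrBl.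
have [e eE] := IHm b (lt_count b hba bP) bP hb.
have [e' eE'] := IHm _ (lt_count _ haba abP) abP hab.
exists (fun d => (e d + e' d)%N); under eq_bigr do rewrite mulrnDr.
by rewrite big_split /= -eE -eE' addrC subrK.
Qed.

Lemma simpleP d : simple Phi h d ->
  [/\ d \in Phi, 0 < h d & forall a, a \in Phi -> 0 < h a -> d - a \in Phi ->
     0 < h (d - a) -> False].
Proof.
case/and3P=> dP hd /hasPn nd; split=> // a aP ha daP hda.
by have := nd a aP; rewrite ha daP hda.
Qed.

Lemma simple_obtuse d d' : simple Phi h d -> simple Phi h d' -> d != d' ->
  dot d d' <= 0.
Proof.
move=> /simpleP[dP hd sd] /simpleP[dP' hd' sd'] dd'.
rewrite leNgt; apply/negP => /(root_sub dP dP' dd') rP.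
have [h0|h0] := ltP 0 (h (d - d')); first exact: (sd d').
have rP' := root_opp rP; rewrite opprB in rP'.
apply: (sd' d) => //; rewrite -opprB functionalN // oppr_gt0.
by rewrite lt_neqAle h0 andbT hn0.
Qed.

Lemma simple_free : free [seq d <- Phi | simple Phi h d].
Proof.
apply: (obtuse_free hl); first by rewrite filter_uniq ?fset_uniq.
  by move=> d; rewrite mem_filter => /andP[/simpleP[]].
move=> d d'; rewrite !mem_filter => /andP[sd _] /andP[sd' _].
exact: simple_obtuse.
Qed.

(** If the image were negative, [a] and [- refl d a] would be nonnegative combinations of simple
    roots whose sum is a multiple of [d]. By independence [a] itself would be a multiple of [d],
    hence equal to [d]. *)
Lemma refl_simple d a : simple Phi h d -> a \in Phi -> 0 < h a -> a != d ->
  0 < h (refl d a).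
Proof.
move=> sd aP ha ad; have [dP hd _] := simpleP sd; have [_ Pr _ Pd] := PhiR.
have bP := Pr d a dP aP; rewrite lt_neqAle eq_sym hn0 //= leNgt; apply/negP => hb.
have [e aE] := simple_decomposition aP ha.
have [|e' bE] := simple_decomposition (root_opp bP); first by rewrite functionalN // oppr_gt0.
pose f x := (e x)%:R + (e' x)%:R - (x == d)%:R * pair a d : R.
have f0 : \sum_(x <- [seq x <- Phi | simple Phi h x]) f x *: x = 0.
  rewrite big_filter; under eq_bigr do rewrite /f scalerBl scalerDl !scaler_nat.
  rewrite sumrB big_split /= -aE -bE -big_filter (bigD1_seq d) /=.
  - rewrite eqxx mul1r big1 => [|x /negPf ->]; last by rewrite mul0r scale0r.
    by rewrite addr0 /refl opprB [a + _]addrC subrK subrr.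
  - by rewrite mem_filter sd.
  - by rewrite filter_uniq // fset_uniq.
have e0 x : simple Phi h x -> x != d -> e x = 0%N.
  move=> sx xd; have [xP _ _] := simpleP sx.
  have := free_coef0 simple_free f0; move=> /(_ x).
  rewrite mem_filter sx xP => /(_ isT) /eqP.
  by rewrite /f (negPf xd) mul0r subr0 -natrD pnatr_eq0 addn_eq0 => /andP[/eqP].
have aE' : a = (e d)%:R *: d.
  rewrite {1}aE -big_filter (bigD1_seq d) /=.
  - rewrite scaler_nat big_seq_cond big1 ?addr0 // => x.
    by rewrite mem_filter => /andP[/andP[sx _] xd]; rewrite e0 // mulr0n.
  - by rewrite mem_filter sd.
  - by rewrite filter_uniq // fset_uniq.
have := Pd d dP (e d)%:R; rewrite -aE' => /(_ aP) [e1|e1].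
  by case/eqP: ad; rewrite aE' e1 scale1r.
by have := ler0n R (e d); rewrite e1 oppr_ge0 ler10.
Qed.

(** The reflection in [d] permutes the positive roots other than [d] and changes the sign of their
    pairings with [d]. These cancel, and only [pair d d] remains. *)
Lemma twice_height_simple d : simple Phi h d -> twice_height Phi h d = 2.
Proof.
move=> sd; have [dP hd _] := simpleP sd; have [_ Pr _ _] := PhiR.
have d0 := Phi0 dP.
rewrite /twice_height -big_filter (bigD1_seq d) /=; last first.
- by rewrite filter_uniq ?fset_uniq.
- by rewrite mem_filter hd.
rewrite pair_self // -big_filter.
set P := filter _ _; suff : \sum_(a <- P) pair d a = - \sum_(a <- P) pair d a by lra.
have uP : uniq P by rewrite !filter_uniq ?fset_uniq.
have sP : perm_eq (map (refl d) P) P.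
  have uS : uniq (map (refl d) P).
    by rewrite map_inj_uniq //; apply: inv_inj; apply: reflK.
  apply: uniq_perm => //.
  suff subP : {subset map (refl d) P <= P}.
    by have [] := uniq_min_size uS subP; rewrite ?size_map.
  move=> _ /mapP[a + ->]; rewrite !mem_filter => /and3P[ad ha aP].
  rewrite Pr // refl_simple // !andbT.
  apply: contraTneq ha => /(congr1 (refl d)); rewrite reflK // refl_self // => ->.
  by rewrite functionalN // oppr_gt0 -leNgt ltW.
rewrite -{1}(perm_big _ sP) /= big_map -sumrN; apply: eq_bigr => a _.
have da : dot d (refl d a) = - dot d a.
  rewrite -[X in dot X _](reflK d0) dot_refl // refl_self //.
  exact: (functionalN _ (dotr_functional _)).
rewrite /pair dot_refl // da.
by rewrite mulrN mulNr.
Qed.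

Lemma twice_height_nat a : a \in Phi -> 0 < h a ->
  exists m, twice_height Phi h a = 2 * m.+1%:R.
Proof.
move=> aP ha; have [e aE] := simple_decomposition aP ha.
have hE : twice_height Phi h a = 2 * (\sum_(d <- Phi | simple Phi h d) e d)%:R.
  rewrite {1}aE (functional_sum _ _ _ (@twice_height_functional _ _)).
  rewrite natr_sum mulr_sumr; apply: eq_bigr => d sd.
  rewrite -scaler_nat (functionalZ _ _ (@twice_height_functional _ _)).
  by rewrite twice_height_simple // mulrC.
move: hE; case: {2}(\sum_(_ <- _ | _) _)%N
  (erefl (\sum_(d <- Phi | simple Phi h d) e d)%N) => [|m] sE.
  move/eqP: sE; rewrite sum_nat_seq_eq0 => /allP e0.
  suff a0 : a = 0 by rewrite a0 functional0 ?ltxx in ha.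
  rewrite aE big_seq_cond; apply: big1 => d /andP[dP sd].
  by have /implyP/(_ sd)/eqP -> := e0 d dP; rewrite mulr0n.
by rewrite sE => ->; exists m.
Qed.

(** Since [dot a a] is positive, some simple root [d] has positive product with [a], so [a - d] is a
    root. Were it negative, [d] would split as [a] plus a positive root. *)
Lemma nonsimple_descent a : a \in Phi -> 0 < h a -> ~~ simple Phi h a ->
  exists d, [/\ simple Phi h d, a - d \in Phi & 0 < h (a - d)].
Proof.
move=> aP ha nsa; have [e aE] := simple_decomposition aP ha.
have [d sd dad] : exists2 d, simple Phi h d & 0 < dot a d.
  have [/hasP[d dP /andP[sd dad]]|/hasPn nd] :=
    boolP (has (fun d => simple Phi h d && (0 < dot a d)) Phi); first by exists d.
  have := dot_gt0 (Phi0 aP); rewrite ltNge => /negP[].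
  rewrite [X in dot _ X]aE functional_sum // big_seq_cond; apply: sumr_le0 => d /andP[dP sd].
  rewrite -scaler_nat functionalZ // mulr_ge0_le0 // leNgt.
  by have := nd d dP; rewrite sd.
have [dP hd sd'] := simpleP sd.
have ad : a != d by apply: contraNneq nsa => ->.
have adP := root_sub aP dP ad dad; exists d; split=> //.
rewrite ltNge; apply/negP => had.
have daP := root_opp adP; rewrite opprB in daP.
apply: (sd' a) => //; rewrite -opprB functionalN // oppr_gt0.
by rewrite lt_neqAle had andbT hn0.
Qed.

(* Each descent step [a - d] from [a] gives a new root below [a], and the
   last one, of height 2, is a sum of two distinct simple roots. *)
Lemma count_below m a : a \in Phi -> 0 < h a ->
  twice_height Phi h a = 2 * m.+2%:R ->
  (m.+2 <= count (fun b => 0 < h b < h a)%R Phi)%N.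
Proof.
have [_ _ _ Pd] := PhiR.
have nsimple k c : twice_height Phi h c = 2 * k.+2%:R -> ~~ simple Phi h c.
  move=> tc; apply/negP => /twice_height_simple tc2.
  have /eqP : k.+2%:R = 1 :> R by lra.
  by rewrite pnatr_eq1.
elim: m a => [|m IHm] a aP ha tha.
  have [d [sd adP had]] := nonsimple_descent aP ha (nsimple _ _ tha).
  have [dP hd _] := simpleP sd.
  have hda : h d < h a by move: had; rewrite functionalB // subr_gt0.
  have hada : h (a - d) < h a by rewrite functionalB // gtrBl.
  have -> : 2%N = size [:: d; a - d] by [].
  rewrite -size_filter; apply: uniq_leq_size => [|x].
    rewrite /= inE andbT; apply/eqP => da.
    have a2 : a = 2 *: d by rewrite scaler_nat mulr2n {2}da addrC subrK.
    by rewrite a2 in aP; case: (Pd d dP 2 aP) => t2; lra.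
  rewrite !inE mem_filter => /orP[] /eqP ->; rewrite ?hd ?hda //.
  by rewrite had hada.
have [d [sd adP had]] := nonsimple_descent aP ha (nsimple _ _ tha).
have [dP hd _] := simpleP sd.
have hada : h (a - d) < h a by rewrite functionalB // gtrBl.
have th' : twice_height Phi h (a - d) = 2 * m.+2%:R.
  rewrite (functionalB _ _ (@twice_height_functional _ _)) tha twice_height_simple //.
  by rewrite -[m.+3]addn1 natrD mulrDr mulr1 addrK.
have := IHm _ adP had th'; rewrite -ltnS => /leq_trans; apply.
rewrite -!size_filter.
apply: (@leq_trans (size (a - d :: [seq x <- Phi | 0 < h x < h (a - d)]))) => //.
apply: uniq_leq_size.
  by rewrite /= filter_uniq ?fset_uniq // mem_filter ltxx andbF.
move=> x; rewrite inE !mem_filter => /orP[/eqP ->|/andP[/andP[hx hxa] ->]].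
  by rewrite had hada.
by rewrite hx (lt_trans hxa hada).
Qed.

End Theory.

Lemma int_lt1_half (t : R) : 2 * t \is a Num.int -> 0 < t < 1 -> t = 1 / 2.
Proof.
move=> ti /andP[t0 t1]; have [t2|] := eqVneq (2 * t) 1; first lra.
have t20 : 0 < 2 * t by lra.
by move/(int_ge2 ti t20) => ?; lra.
Qed.

(** * Roots in the span of a height level *)

Section LowRoots.
Variables (Phi : {fset E}) (h : E -> R) (n : R).
Hypotheses (PhiR : rootset Phi) (hl : functional h).
Hypothesis hn0 : {in Phi, forall a, h a != 0}.
Hypothesis n_gt0 : 0 < n.

Let level := [seq a <- Phi | h a == n].

(* The roots whose height is a multiple of [n] form a root system in which the
   roots of height [n] are simple; so its half sum of positive coroots has
   height [h / n] on their span, and the pairings being integers, [2 h / n]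
   is integral on all roots in the span. *)
Lemma low_root_half c : c \in Phi -> c \in <<level>>%VS -> 0 < h c < n ->
  h c = n / 2.
Proof.
move=> cP cS /andP[hc hcn]; have [_ Pr Pi _] := PhiR.
pose Psi := [fset a in Phi | h a / n \is a Num.int].
have PsiR : rootset Psi.
  apply: (rootset_sub PhiR) => a b aP bP ai bi.
  rewrite /refl functionalB // functionalZ // mulrBl -mulrA.
  by rewrite rpredB // rpredM // Pi.
have sub a : a \in Psi -> a \in Phi by rewrite !inE => /andP[].
have Psin0 : {in Psi, forall a, h a != 0} by move=> a /sub/hn0.
have lev b : b \in level -> twice_height Psi h b = 2.
  rewrite mem_filter => /andP[/eqP hb bP].
  apply: (twice_height_simple PsiR hl Psin0); apply/and3P; split.
  - by rewrite !inE bP /= hb divff ?gt_eqF // rpred1.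
  - by rewrite hb.
  apply/hasPn => a aPsi; apply/negP => /and3P[ha _].
  move: aPsi; rewrite !inE /= => /andP[aP ai].
  have := int_gt0 ai; rewrite divr_gt0 // => /(_ isT).
  by rewrite ler_pdivlMr // mul1r functionalB // hb subr_gt0 ltNge => ->.
have hE : twice_height Psi h c = 2 * (h c / n).
  apply/eqP; rewrite -subr_eq0; apply/eqP.
  pose f x := twice_height Psi h x - 2 * (h x / n).
  have fl : functional f.
    move=> t x y; rewrite /f twice_height_functional hl; field.
    exact: lt0r_neq0.
  apply: (functional_span fl _ cS) => b bl; rewrite /f lev //.
  move: bl; rewrite mem_filter => /andP[/eqP -> _].
  by rewrite divff ?gt_eqF // mulr1 subrr.
have ti : twice_height Psi h c \is a Num.int.
  rewrite /twice_height big_seq_cond; apply: rpred_sum => a /andP[/sub aP _].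
  exact: Pi.
have e : h c / n = 1 / 2.
  apply: int_lt1_half; first by rewrite -hE.
  by rewrite divr_gt0 //= ltr_pdivrMr // mul1r.
by rewrite -[LHS](divfK (lt0r_neq0 n_gt0)) e; lra.
Qed.

(* Otherwise let [Gam] be the roots of height [n / 2] in the span. The roots
   of height [n] that are sums of two elements of [Gam] are at least as many
   as [Gam], because the others together with [Gam] are independent. But they
   are edges of the Dynkin graph on the obtuse family [Gam], which is a
   forest. *)
Lemma no_low_root c : c \in Phi -> c \in <<level>>%VS -> ~ (0 < h c < n).
Proof.
move=> cP cS hc; have [_ Pr Pi Pd] := PhiR.
have half := low_root_half; have hcn := half c cP cS hc.
pose Gam := [seq a <- Phi | (a \in <<level>>%VS) && (h a == n / 2)].
have GamP g : g \in Gam -> [/\ g \in Phi, g \in <<level>>%VS & h g = n / 2].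
  by rewrite mem_filter => /andP[/andP[gS /eqP hg] gP].
have uG : uniq Gam by rewrite filter_uniq ?fset_uniq.
have cG : c \in Gam by rewrite mem_filter cS hcn eqxx.
have levP b : b \in level -> b \in Phi /\ h b = n.
  by rewrite mem_filter => /andP[/eqP].
have n2 : 0 < n / 2 by rewrite divr_gt0.
pose split b := has (fun g => b - g \in Gam) Gam.
pose D := [seq b <- level | split b].
pose N := [seq b <- level | ~~ split b].
have NP b : b \in N -> b \in level by rewrite mem_filter => /andP[].
have subG b g : b \in level -> g \in Gam -> b - g \in Phi -> b - g \in Gam.
  move=> bl /GamP[gP gS hg] bgP; rewrite mem_filter bgP andbT.
  apply/andP; split; first by apply: memvB => //; apply: memv_span.
  by rewrite functionalB // hg (levP b bl).2; apply/eqP; lra.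
have size_GD : (size Gam <= size D)%N.
  have fNG : free (N ++ Gam).
    apply: (obtuse_free hl).
    - rewrite cat_uniq uG !filter_uniq ?fset_uniq //= andbT.
      apply/hasPn => g /GamP[_ _ hg]; rewrite mem_filter; apply/negP => /andP[_].
      by move/levP => [_]; rewrite hg => ?; lra.
    - move=> x; rewrite mem_cat mem_filter => /orP[/andP[_ /levP[_ ->]] //|].
      by case/GamP => _ _ ->.
    have mixed b g : b \in N -> g \in Gam -> dot b g <= 0.
      rewrite mem_filter => /andP[nb bl] gG; have [gP _ hg] := GamP g gG.
      rewrite leNgt; apply/negP => dbg; case/hasP: nb; exists g => //.
      apply: subG => //; apply: (root_sub PhiR) => //; first by case: (levP b bl).
      apply/eqP => bg; have [_] := levP b bl; rewrite bg hg => ?; lra.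
    move=> x y; rewrite !mem_cat => /orP[xN|xG] /orP[yN|yG] xy.
    - have [[xP hx] [yP hy]] := (levP x (NP x xN), levP y (NP y yN)).
      by apply: (same_height_obtuse PhiR hl hn0) => //; rewrite hx hy.
    - exact: mixed.
    - by rewrite dotC; apply: mixed.
    have [xP _ hx] := GamP x xG; have [yP _ hy] := GamP y yG.
    by apply: (same_height_obtuse PhiR hl hn0) => //; rewrite hx hy.
  have : (size (N ++ Gam) <= size level)%N.
    rewrite -(eqP fNG); apply: leq_trans (dim_span level); apply: dimvS.
    apply/span_subvP => x; rewrite mem_cat => /orP[|/GamP[] //].
    by rewrite mem_filter => /andP[_ xl]; apply: memv_span.
  rewrite size_cat -(count_predC split level) !size_filter addnC.
  by rewrite leq_add2r.
pose len g := Num.sqrt (dot g g).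
have len_gt0 g : g \in Gam -> 0 < len g.
  case/GamP => gP _ _; rewrite sqrtr_gt0 dot_gt0 //.
  by have [P0 _ _ _] := PhiR; apply: contraNneq P0 => <-.
have len2 g : g \in Gam -> len g * len g = dot g g.
  move=> /len_gt0; rewrite /len sqrtr_gt0 => g0.
  by rewrite -expr2 sqr_sqrtr // ltW.
pose e g g' := dot g g' / (len g * len g').
pose edge g g' := ((g + g' \in D) : nat)%:R : R.
have e_le g g' : g \in Gam -> g' \in Gam -> e g g' <= (g == g')%:R - edge g g' / 2.
  move=> gG gG'; have [gP gS hg] := GamP g gG; have [gP' _ hg'] := GamP g' gG'.
  have l0 := len_gt0 g gG; have l0' := len_gt0 g' gG'.
  have l2 := len2 g gG; have l2' := len2 g' gG'.
  rewrite /e ler_pdivrMr ?mulr_gt0 // /edge; have [<-|gg'] := eqVneq g g'.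
    rewrite (_ : (g + g \in D) = false) ?mul0r ?subr0 ?mul1r ?l2 //.
    apply/negP; rewrite mem_filter => /andP[_ /levP[]].
    by rewrite -mulr2n -scaler_nat => /(Pd g gP) [] ?; lra.
  have ob : dot g g' <= 0 by apply: (same_height_obtuse PhiR hl hn0) => //; rewrite hg hg'.
  have [gD|] := boolP (g + g' \in D); last by rewrite mul0r subr0 mul0r.
  have bP : g + g' \in Phi by move: gD; rewrite mem_filter => /andP[_ /levP[]].
  (* If the product were 0, reflecting [g + g'] in [g] would give the root [g' - g] of height 0. *)
  have dot_lt0 : dot g g' < 0.
    rewrite lt_neqAle ob andbT; apply/eqP => d0.
    have gg : dot g g != 0 by rewrite -l2 mulf_neq0 ?gt_eqF.
    have := Pr g _ gP bP; rewrite /refl /pair.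
    rewrite (functionalD _ _ (dotr_functional g)) (dotC g') d0 addr0 mulfK //.
    rewrite scaler_nat mulr2n opprD addrACA subrr add0r => /hn0.
    by rewrite functionalB // hg hg' subrr eqxx.
  (* A negative integral pairing is at most -1. Used in both orders, this bounds the cosine between
     the ends of an edge by -1/2. *)
  have pair_le a b : a \in Gam -> b \in Gam -> dot a b < 0 -> 2 * dot a b <= - dot b b.
    move=> aG bG dab; have [aP _ _] := GamP a aG; have [bP' _ _] := GamP b bG.
    have bb : 0 < dot b b by rewrite -len2 // mulr_gt0 ?len_gt0.
    have : 0 < - pair a b by rewrite /pair -mulNr divr_gt0 // -mulrN mulr_gt0 // oppr_gt0.
    have pi : - pair a b \is a Num.int by rewrite rpredN; apply: Pi.
    by move/(int_gt0 pi); rewrite /pair -mulNr ler_pdivlMr // mul1r => ?; lra.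
  have p1 := pair_le g g' gG gG' dot_lt0.
  have p2 : 2 * dot g g' <= - dot g g.
    by rewrite dotC; apply: pair_le; rewrite // dotC.
  rewrite -l2 in p2; rewrite -l2' in p1.
  change (dot g g' <= (0 - 1 / 2) * (len g * len g')).
  have [ll|/ltW ll] := leP (len g) (len g').
    by have := ler_wpM2r (ltW l0') ll; lra.
  by have := ler_wpM2l (ltW l0) ll; lra.
(* The sum of the unit vectors along [Gam]: its squared length is positive and at most vertices
   minus edges, against [size_GD]. *)
pose u := \sum_(g <- Gam) (len g)^-1 *: g.
have u0 : u != 0.
  suff : h u != 0 by apply: contra_neq => ->; rewrite functional0.
  rewrite gt_eqF // functional_sum // (bigD1_seq c) //= ltr_wpDr //.
    rewrite big_seq_cond; apply: sumr_ge0 => g /andP[gG _].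
    have [_ _ hg] := GamP g gG.
    by rewrite functionalZ // hg mulr_ge0 ?invr_ge0 // ltW // len_gt0.
  by rewrite functionalZ // hcn mulr_gt0 // invr_gt0 len_gt0.
have uE : dot u u = \sum_(g <- Gam) \sum_(g' <- Gam) e g g'.
  rewrite {1}/u (functional_sum _ _ _ (dotr_functional _)); apply: eq_bigr => g _.
  rewrite (functionalZ _ _ (dotr_functional _)) /u functional_sum // mulr_sumr.
  apply: eq_bigr => g' _; rewrite functionalZ // /e invfM.
  by rewrite mulrCA mulrC -mulrA [RHS]mulrC mulrCA mulrC.
(* Each [b] in [D] comes from at least two ordered pairs, since [b = 2 *: g0] is excluded in a
   reduced system. *)
have edges : 2 * (size D)%:R <= \sum_(g <- Gam) \sum_(g' <- Gam) edge g g'.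
  have edgeE g g' : edge g g' = \sum_(b <- D) (g + g' == b)%:R.
    have uD : uniq D by rewrite !filter_uniq ?fset_uniq.
    rewrite /edge; have [gD|gD] := boolP (g + g' \in D).
      rewrite (bigD1_seq (g + g')) //= eqxx big1 ?addr0 // => b /negPf.
      by rewrite eq_sym => ->.
    rewrite big_seq big1 // => b bD; case: eqP => // gb.
    by rewrite gb bD in gD.
  under eq_bigr => g _ do (under eq_bigr => g' _ do rewrite edgeE; rewrite exchange_big /=).
  rewrite exchange_big /= -sum1_size natr_sum mulr_sumr.
  rewrite big_seq [X in _ <= X]big_seq; apply: ler_sum => b.
  rewrite mem_filter => /andP[/hasP[g0 gG0 bG0] bl].
  have -> : \sum_(g <- Gam) \sum_(g' <- Gam) (g + g' == b)%:R =
      (count (fun g => b - g \in Gam) Gam)%:R :> R.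
    rewrite -sum1_count natr_sum [RHS]big_mkcond /=; apply: eq_bigr => g _.
    have [bG|bG] := boolP (b - g \in Gam).
      rewrite (bigD1_seq (b - g)) //= [g + _]addrC subrK eqxx big1 ?addr0 // => g' /negPf g'b.
      by case: eqP => // gb; rewrite -gb addrC addKr eqxx in g'b.
    rewrite big_seq big1 // => g' gG'; case: eqP => // gb.
    by rewrite -gb addrC addKr gG' in bG.
  rewrite mulr1 ler_nat -size_filter.
  rewrite -[2%N]/(size [:: g0; b - g0]); apply: uniq_leq_size => [|x].
    rewrite /= inE andbT; apply/eqP => gb; have [gP0 _ _] := GamP g0 gG0.
    have : 2 *: g0 \in Phi by rewrite scaler_nat mulr2n {2}gb addrC subrK; case: (levP b bl).
    by case/(Pd g0 gP0) => ?; lra.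
  rewrite !inE mem_filter => /orP[] /eqP ->; rewrite ?gG0 ?bG0 //.
  by rewrite opprB addrC subrK gG0.
have : dot u u <= (size Gam)%:R - (size D)%:R.
  apply: (@le_trans _ _ (\sum_(g <- Gam) \sum_(g' <- Gam) ((g == g')%:R - edge g g' / 2))).
    rewrite uE big_seq [X in _ <= X]big_seq; apply: ler_sum => g gG.
    by rewrite big_seq [X in _ <= X]big_seq; apply: ler_sum => g' gG'; apply: e_le.
  under eq_bigr => g _ do rewrite sumrB -mulr_suml.
  rewrite sumrB -mulr_suml.
  have -> : \sum_(g <- Gam) \sum_(g' <- Gam) (g == g')%:R = (size Gam)%:R :> R.
    rewrite -sum1_size natr_sum big_seq [RHS]big_seq; apply: eq_bigr => g gG.
    by rewrite (bigD1_seq g) //= eqxx big1 ?addr0 // => g' /negPf; rewrite eq_sym => ->.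
  lra.
rewrite leNgt => /negP; apply; apply: le_lt_trans (dot_gt0 u0).
by rewrite subr_le0 ler_nat.
Qed.

End LowRoots.

(** * Planes through a root and local heights *)

Section PlaneClasses.
Variables (Phi : {fset E}) (h : E -> R).
Hypotheses (PhiR : rootset Phi) (hl : functional h).
Hypothesis hn0 : {in Phi, forall a, h a != 0}.
Hypothesis hE : forall x, twice_height Phi h x = 2 * h x.
Variable b : E.
Hypotheses (bP : b \in Phi) (hb : 0 < h b).

Definition plane a := (<[a]> + <[b]>)%VS.

(* The roots lower than [b]; two of them have the same trace on the hyperplane
   of [b] iff they span the same plane with [b]. *)
Definition low := [seq a <- Phi | 0 < h a < h b].

(** The list depends on [a] only through its plane, so all members of a class share one
    representative. The default 0 is not reached for [a] in [low], which occurs in its own list. *)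
Definition rep a := head 0 [seq c <- low | plane c == plane a].

Lemma not_parallel a (t : R) : a \in Phi -> 0 < h a -> a != b -> a <> t *: b.
Proof.
move=> aP ha ab at0; have [_ _ _ Pd] := PhiR.
case: (Pd b bP t); first by rewrite -at0.
  by move=> t1; rewrite at0 t1 scale1r eqxx in ab.
move=> t1; move: ha; rewrite at0 t1 scaleN1r functionalN // oppr_gt0.
by rewrite ltNge ltW.
Qed.

Lemma plane_eq a c s t : s != 0 -> a = s *: c + t *: b -> plane a = plane c.
Proof.
move=> sn0 aE; apply/eqP; rewrite eqEsubv !subv_add !addvSr !andbT /plane.
rewrite -!memvE; apply/andP; split.
  rewrite aE; apply: memv_add; apply: memvZ; exact: memv_line.
have -> : c = s^-1 *: a + (- (s^-1 * t)) *: b.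
  rewrite aE scalerDr !scalerA mulVf // scale1r scaleNr addrK //.
apply: memv_add; apply: memvZ; exact: memv_line.
Qed.

Lemma plane_mem a c : a \in plane c -> exists s t, a = s *: c + t *: b.
Proof.
by case/memv_addP => _ /vlineP[s ->] [_ /vlineP[t ->] ->]; exists s, t.
Qed.

Lemma plane_self a : a \in plane a.
Proof. by rewrite -[X in X \in _]addr0; apply: memv_add; [apply: memv_line|apply: mem0v]. Qed.

Lemma plane_eqP a c : a \in Phi -> 0 < h a -> a != b ->
  (a \in plane c) = (plane a == plane c).
Proof.
move=> aP ha ab; apply/idP/eqP => [/plane_mem[s [t aE]]|<-]; last exact: plane_self.
apply: (plane_eq _ aE); apply/eqP => s0.
by apply: (not_parallel (t := t) aP ha ab); rewrite aE s0 scale0r add0r.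
Qed.

Lemma lowP a : a \in low -> [/\ a \in Phi, 0 < h a, h a < h b & a != b].
Proof.
rewrite mem_filter => /andP[/andP[ha hab] aP]; split=> //.
by apply: contraTneq hab => ->; rewrite ltxx.
Qed.

Lemma repP a : a \in low -> rep a \in low /\ plane (rep a) = plane a.
Proof.
move=> al; have : rep a \in [seq c <- low | plane c == plane a].
  rewrite /rep; have : a \in [seq c <- low | plane c == plane a].
    by rewrite mem_filter eqxx.
  by case: [seq _ <- _ | _] => [//|x s _]; rewrite mem_head.
by rewrite mem_filter => /andP[/eqP].
Qed.

Lemma rep_span a : a \in low -> exists st : R * R, a = st.1 *: rep a + st.2 *: b.
Proof.
move=> /repP[_ pE]; have := plane_self a; rewrite -pE => /plane_mem[s [t aE]].
by exists (s, t).
Qed.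

Lemma rep_class a c s t : a \in low -> c \in low -> a = s *: c + t *: b -> rep a = rep c.
Proof.
move=> /lowP[aP ha _ ab] cl aE; rewrite /rep (plane_eq _ aE) //.
apply/eqP => s0; apply: (not_parallel (t := t) aP ha ab).
by rewrite aE s0 scale0r add0r.
Qed.

(* The local height of [b] in the plane [plane c] is one plus half the sum of
   the pairings with the positive roots of that plane other than [b]. *)
Lemma plane_count c : c \in Phi -> 0 < h c -> c != b ->
  exists2 m : nat,
    \sum_(a <- Phi | [&& 0 < h a, a != b & plane a == plane c]) pair b a = 2 * m%:R &
    (m <= count (fun a => (rep a != a) && (plane a == plane c)) low)%N.
Proof.
move=> cP hc cb; have [_ Pr _ _] := PhiR.
pose Psi := [fset a in Phi | a \in plane c].
have PsiR : rootset Psi.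
  by apply: (rootset_sub PhiR) => a a' _ _ aU aU'; apply: memvB => //; apply: memvZ.
have sub a : a \in Psi -> a \in Phi by rewrite !inE => /andP[].
have Psin0 : {in Psi, forall a, h a != 0} by move=> a /sub/hn0.
have bU : b \in plane c by rewrite -[b]add0r; apply: memv_add; [apply: mem0v|apply: memv_line].
have bPsi : b \in Psi by rewrite !inE bP.
have [m mE] := twice_height_nat PsiR hl Psin0 bPsi hb.
have uF P : uniq [seq a <- Psi | P a] by rewrite filter_uniq ?fset_uniq.
exists m.
  have <- : \sum_(a <- Psi | (0 < h a) && (a != b)) pair b a = 2 * m%:R.
    have := mE; rewrite /twice_height -big_filter (bigD1_seq b) ?mem_filter ?hb //=.
    rewrite pair_self; last by have [P0 _ _ _] := PhiR; apply: contraNneq P0 => <-.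
    rewrite -[m.+1%:R]natr1 mulrDr mulr1 addrC => /addIr <-.
    by rewrite big_filter_cond.
  rewrite -big_filter -[RHS]big_filter; apply: perm_big; apply: uniq_perm => // [|a].
    by rewrite filter_uniq ?fset_uniq.
  rewrite !mem_filter !inE /=.
  have [ha|//] := boolP (0 < h a); have [->|ab] := eqVneq a b; first by [].
  have [aP|_] := boolP (a \in Phi); last by rewrite !andbF.
  by rewrite plane_eqP // !andbT.
(* At local height [m.+2] there are at least [m.+2] lower positive roots in the plane, by
   [count_below]. At most one of them is its own representative, which leaves the required
   [m.+1]. *)
case: m mE => [//|m] mE.
have := count_below PsiR hl Psin0 bPsi hb mE.
have -> : count (fun a => 0 < h a < h b) Psi =
          count (fun a => plane a == plane c) low.
  rewrite -!size_filter; apply/perm_size/uniq_perm => // [|a].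
    by rewrite !filter_uniq ?fset_uniq.
  rewrite !mem_filter !inE /=.
  have [/andP[ha hab]|//] := boolP (0 < h a < h b); last by rewrite andbF.
  have ab : a != b by apply: contraTneq hab => ->; rewrite ltxx.
  have [aP|_] := boolP (a \in Phi); last by rewrite !andbF.
  by rewrite plane_eqP // !andbT.
set p := fun a => plane a == plane c.
move=> mle.
have cE := count_predC (fun a => rep a == a) (filter p low).
rewrite size_filter in cE.
have le1 : (count (fun a => rep a == a) [seq a <- low | p a] <= 1)%N.
  rewrite -size_filter.
  apply: (@uniq_leq_size _ _ [:: head 0 [seq c' <- low | p c']]).
    by rewrite !filter_uniq ?fset_uniq.
  move=> a; rewrite mem_filter => /andP[/eqP ra]; rewrite mem_filter => /andP[/eqP pa _].
  by rewrite inE -{1}ra /rep pa.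
rewrite -/p -cE in mle; rewrite -ltnS; apply: leq_trans mle _.
have <- : count (predC (fun a => rep a == a)) (filter p low) =
    count (fun a => (rep a != a) && p a) low by rewrite count_filter.
by rewrite -add1n leq_add2r.
Qed.

(** Every positive root other than [b] spans one plane with [b]. The pairing of [b] with itself uses
    up 2 of twice its height; the remaining [2 * k] is distributed over these planes and bounded in
    each by [plane_count]. *)
Lemma count_rep k : h b = k.+1%:R -> (k <= count (fun a => rep a != a) low)%N.
Proof.
move=> hbk; pose P := [seq a <- Phi | (0 < h a) && (a != b)].
have b0 : b != 0 by have [P0 _ _ _] := PhiR; apply: contraNneq P0 => <-.
pose U := undup (map plane P).
have PU : {in Phi, forall a, (0 < h a) && (a != b) -> plane a \in U}.
  by move=> a aP ha; rewrite mem_undup map_f // mem_filter ha.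
have [m mE mle] : exists2 m : {vspace E} -> nat,
    {in U, forall u, \sum_(a <- Phi | ((0 < h a) && (a != b)) && (plane a == u)) pair b a
      = 2 * (m u)%:R} &
    {in U, forall u, (m u <= count (fun a => (rep a != a) && (plane a == u)) low)%N}.
  have ex u : exists m : nat, u \in U ->
      \sum_(a <- Phi | ((0 < h a) && (a != b)) && (plane a == u)) pair b a = 2 * m%:R /\
      (m <= count (fun a => (rep a != a) && (plane a == u)) low)%N.
    have [|_] := boolP (u \in U); last by exists 0%N.
    rewrite mem_undup => /mapP[c]; rewrite mem_filter => /andP[/andP[hc cb] cP] ->.
    have [m mE mle] := plane_count cP hc cb; exists m => _; split=> //.
    by rewrite -mE; apply: eq_bigl => a; rewrite andbA.
  have [m mP] := boolp.choice ex.
  by exists m => u uU; have [] := mP u uU.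
have tot : 2 * k%:R = 2 * (\sum_(u <- U) m u)%:R :> R.
  have <- : \sum_(a <- Phi | (0 < h a) && (a != b)) pair b a = 2 * k%:R.
    have := hE b; rewrite hbk -[k.+1%:R]natr1 mulrDr mulr1 addrC.
    rewrite /twice_height -big_filter (bigD1_seq b) /=; last first.
    - by rewrite filter_uniq ?fset_uniq.
    - by rewrite mem_filter hb.
    by rewrite big_filter_cond pair_self // => /addrI.
  rewrite (big_by_class _ _ (undup_uniq _) PU) natr_sum mulr_sumr.
  by rewrite big_seq [RHS]big_seq; apply: eq_bigr => u uU; apply: mE.
have -> : k = (\sum_(u <- U) m u)%N.
  by apply/eqP; rewrite -(eqr_nat R); apply/eqP; lra.
have lU : {in low, forall a, rep a != a -> plane a \in U}.
  by move=> a /lowP[aP ha _ ab] _; apply: PU => //; rewrite ha.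
rewrite -sum1_count (big_by_class _ _ (undup_uniq _) lU).
rewrite big_seq [X in (_ <= X)%N]big_seq; apply: leq_sum => u uU.
by rewrite sum1_count; apply: mle.
Qed.

End PlaneClasses.
End RootSets.

(** * Multiple addition *)

Section AdditionPolynomial.
Variables (K : fieldType) (V : vectType K).
Local Notation S := (symdual V).
Variables (A : seq 'Hom(V, K^o)) (b : 'Hom(V, K^o)) (p : V).
Variable r : 'Hom(V, K^o) -> 'Hom(V, K^o).
Implicit Types (a c : 'Hom(V, K^o)).
Hypotheses (An : nonparallel A) (bp : b p = 1).
Hypothesis Ab : {in A, forall a (t : K), a <> t *: b}.
Hypothesis rA : {in A, forall a, r a \in A}.
Hypothesis r_span : {in A, forall a, exists st : K * K, a = st.1 *: r a + st.2 *: b}.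
Hypothesis r_class : {in A &, forall a c (s t : K), a = s *: c + t *: b -> r a = r c}.

Local Notation pi := (pullback (proj_along b p)).

(* [r] selects one representative in each class of hyperplanes having the same
   trace on [b = 0]. *)
Definition addition_poly : S := \prod_(a <- A | r a != a) pi (form_poly a).

Lemma pi_b : pi (form_poly b) = 0.
Proof. by rewrite pullback_proj_form bp scale1r subrr form_poly0. Qed.

Lemma pi_form_neq0 a : a \in A -> pi (form_poly a) != 0.
Proof.
move=> aA; rewrite pullback_proj_form form_poly_neq0 // subr_eq0.
by apply/eqP; apply: Ab.
Qed.

Lemma r_idem a : a \in A -> r (r a) = r a.
Proof.
move=> aA; have [st aE] := r_span aA.
by rewrite -(r_class aA (rA aA) aE).
Qed.

Lemma pi_coprime a c : a \in A -> c \in A -> r a != r c ->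
  mcoprime (pi (form_poly a)) (pi (form_poly c)).
Proof.
move=> aA cA rac; rewrite !pullback_proj_form; apply: form_coprime.
  by rewrite subr_eq0; apply/eqP; apply: Ab.
move=> t /eqP; rewrite subr_eq scalerBr -addrA scalerA -scaleNr -scalerDl.
by move=> /eqP /(r_class aA cA) acE; rewrite acE eqxx in rac.
Qed.

(* [c * th b - b * th c] is antisymmetric, hence unchanged up to a scalar when
   [c] is replaced by a combination [s *: c + t *: b]. *)
Lemma class_dvd th c a : logv A th -> c \in A -> a \in A -> r a = c -> 
  mdvd (form_poly a) (form_poly c * vf th b - form_poly b * vf th c).
Proof.
move=> thL cA aA rac; have [[s t] /= aE] := r_span aA; rewrite rac in aE.
have sn0 : s != 0.
  apply: contra_notN (Ab aA (t := t)) => /eqP s0.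
  by rewrite aE s0 scale0r add0r.
have : mdvd (form_poly a) (s *: (form_poly c * vf th b - form_poly b * vf th c)).
  have -> : s *: (form_poly c * vf th b - form_poly b * vf th c) =
            form_poly a * vf th b - form_poly b * vf th a.
    rewrite {1 2}aE vfD form_polyD !vfZ !form_polyZ.
    rewrite mulrDl mulrDr -!scalerAl -!scalerAr opprD addrACA subrr addr0.
    exact: scalerBr.
  apply: mdvdB; first by exists (vf th b).
  by apply: mdvdMr; apply: thL.
by move/mdvdZ => /(_ s^-1); rewrite scalerA mulVf // scale1r.
Qed.

(** In the class of a representative [c], all forms divide [c * th b - b * th c]. On [b = 0] the
    second term vanishes; cancelling the trace of [c] leaves the traces of the other members as
    divisors of [th b]. Distinct classes have coprime traces. *)
Lemma addition_poly_dvd th : logv A th -> mdvd addition_poly (pi (vf th b)).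
Proof.
move=> thL; have [uA A0 Ap] := An.
rewrite /addition_poly (@big_by_class _ _ _ _ _ A [seq a <- A | r a == a] r); last first.
- by move=> a aA _; rewrite mem_filter rA // r_idem // eqxx.
- exact: filter_uniq.
apply: mdvd_prod => [|c c'|c]; first exact: filter_uniq.
- rewrite !mem_filter => /andP[/eqP rc cA] /andP[/eqP rc' cA'] cc'.
  apply: mcoprime_prodl => a aA /andP[_ /eqP ra].
  apply: mcoprime_prodr => [a' aA' _|a' aA' /andP[_ /eqP ra']].
    exact: pi_form_neq0.
  by apply: pi_coprime; rewrite // ra ra'.
rewrite mem_filter => /andP[/eqP rc cA].
have [u uE] : mdvd (\prod_(a <- [seq a <- A | r a == c]) form_poly a)
    (form_poly c * vf th b - form_poly b * vf th c).
  apply: mdvd_prod => [|a a'|a]; first exact: filter_uniq.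
    rewrite !mem_filter => /andP[_ aA] /andP[_ aA'].
    exact: nonparallel_coprime An aA aA'.
  by rewrite mem_filter => /andP[/eqP rac aA]; apply: class_dvd.
exists (pi u); apply: (mulfI (pi_form_neq0 cA)).
have := congr1 pi uE; rewrite rmorphB /= !rmorphM /= pi_b mul0r subr0 => ->.
rewrite mulrA; congr (_ * _); rewrite rmorph_prod big_filter.
rewrite big_mkcond (bigD1_seq c) //= rc eqxx; congr (_ * _).
rewrite [RHS]big_mkcond /= [LHS]big_mkcond /=; apply: eq_bigr => a _.
have [->|ac] := eqVneq a c; first by rewrite rc eqxx.
have [->|//] := eqVneq (r a) c; first by rewrite eq_sym ac.
by rewrite andbF.
Qed.

Lemma addition_poly_homog :
  addition_poly \is (count (fun a => r a != a) A).-homog.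
Proof.
rewrite /addition_poly -sum1_count; apply: dhomog_bigprod => a _.
exact/pullback_homog/form_poly_homog.
Qed.

End AdditionPolynomial.

(** * Base change and Saito matrices under addition *)

Section MultipleAddition.
Variables (K : fieldType) (V : vectType K).
Local Notation n := (\dim {:V}).
Local Notation S := (symdual V).
Local Notation form := ('Hom(V, K^o)).
Implicit Types (a b : form) (F A B : seq form) (x : V).

Definition log_matrix F (d : 'I_n -> nat) (M : 'M[S]_n) :=
  (forall i, logv F (row i M)) /\ (forall i j, M i j \is (d i).-homog).

(** By [saito_det] the determinant vanishes only on the hyperplanes. *)
Lemma saito_unit F d M x : nonparallel F -> log_matrix F d M ->
  (\sum_i d i)%N = size F -> \det M != 0 -> {in F, forall a : form, a x != 0} ->
  map_mx (evalv x) M \in unitmx.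
Proof.
move=> Fn [ML Md] dF Mn0 Fx; have [c cn0 cE] := saito_det Fn ML Md dF Mn0.
rewrite unitmxE unitfE det_map_mx cE /= evalvZ mulf_neq0 // rmorph_prod.
rewrite big_seq_cond; elim/big_ind: _ => [|u v un0 vn0|a /andP[aF _]].
- exact: oner_neq0.
- exact: mulf_neq0.
- by rewrite /= evalv_form Fx.
Qed.

Lemma evalv_vf_unit M x a : map_mx (evalv x) M \in unitmx ->
  (forall i, evalv x (vf (row i M) a) = 0) -> a = 0.
Proof.
move=> Mu a0; pose w := \col_(j < n) (a (vbasis {:V})`_j : K).
have : map_mx (evalv x) M *m w = 0.
  apply/matrixP => i j; rewrite ord1 !mxE -[RHS](a0 i) /vf rmorph_sum /=.
  by apply: eq_bigr => k _; rewrite !mxE evalvZ mulrC.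
move/(congr1 (mulmx (invmx (map_mx (evalv x) M)))).
rewrite mulKmx // mulmx0 => w0; apply/lfunP => v.
rewrite (coord_vbasis (memvf v)) linear_sum lfunE /= big1 // => j _.
rewrite linearZ /=; have := congr1 (fun u : 'cV_n => u j 0) w0.
by rewrite !mxE => ->; rewrite scaler0.
Qed.

Lemma evalv_vf_sum x th I (r : seq I) (P : pred I) (v : I -> K) (F : I -> form) :
  evalv x (vf th (\sum_(i <- r | P i) v i *: F i)) =
  \sum_(i <- r | P i) v i * evalv x (vf th (F i)).
Proof.
by rewrite vf_lincomb rmorph_sum; apply: eq_bigr => i _; apply: evalvZ.
Qed.

(* Otherwise the [#|J| + 1] independent forms [b :: B1] vanish on all rows
   outside [J], so some nontrivial combination of them vanishes on every row. *)
Lemma exists_transverse_row M x (B1 : seq form) b (J : {set 'I_n}) :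
  map_mx (evalv x) M \in unitmx -> free (b :: B1) -> #|J| = size B1 ->
  (forall i, i \notin J -> {in B1, forall c, evalv x (vf (row i M) c) = 0}) ->
  exists2 i, i \notin J & evalv x (vf (row i M) b) != 0.
Proof.
move=> Mu bfree cJ J0; apply/exists_inP; apply: contraT.
rewrite negb_exists_in => /forall_inP b0.
set L := b :: B1 in bfree; have sL : size L = #|J|.+1 by rewrite cJ.
pose Z : 'M[K]_(#|J|, size L) :=
  \matrix_(i, j) evalv x (vf (row (enum_val i) M) L`_j).
have [v vn0 vZ] : exists2 v : 'rV[K]_(size L), v != 0 & v *m Z^T = 0.
  have : kermx Z^T != 0.
    rewrite -mxrank_eq0 mxrank_ker mxrank_tr -lt0n subn_gt0.
    by rewrite (leq_ltn_trans (rank_leq_row Z)) // sL.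
  by case/rowV0Pn => v /sub_kermxP vZ vn0; exists v.
have /(evalv_vf_unit Mu) L0 i : evalv x (vf (row i M) (\sum_j v 0 j *: L`_j)) = 0.
  rewrite evalv_vf_sum; have [iJ|iJ] := boolP (i \in J).
    have := congr1 (fun u : 'rV_(#|J|) => u 0 (enum_rank_in iJ i)) vZ.
    rewrite [LHS]mxE [RHS]mxE => h; rewrite -[RHS]h; apply: eq_bigr => j _.
    by rewrite !mxE enum_rankK_in.
  apply: big1 => j _; have := mem_nth 0 (ltn_ord j).
  rewrite inE => /orP[/eqP ->|jB]; last by rewrite J0 ?mulr0.
  by have := b0 i iJ; rewrite negbK => /eqP ->; rewrite mulr0.
case/eqP: vn0; apply/rowP => j; rewrite mxE.
exact: (elimT (freeP (X := in_tuple L)) bfree (fun j => v 0 j) L0).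
Qed.

Variables (A : seq form) (k : nat) (x : V) (d : 'I_n -> nat).
Hypothesis dk : forall i, (d i <= k)%N.

(* [th b] restricted to the hyperplane [b = 0] has a fixed factor of degree at
   least [k] for every [th] in D(A). *)
Definition addition_bound b := exists (p : V) (q : S) (e : nat),
  [/\ b p = 1, q \is e.-homog, (k <= e)%N &
   forall th, logv A th -> mdvd q (pullback (proj_along b p) (vf th b))].

(* [s i = Some b] records that row [i] is tangent to all the hyperplanes of
   [B1] except [b = 0], so that it has to be multiplied by [b]. *)
Definition addition_state B1 M (s : 'I_n -> option form) :=
  [/\ log_matrix A d M, map_mx (evalv x) M \in unitmx,
      #|[set i | isSome (s i)]| = size B1,
      (forall i b, s i = Some b -> b \in B1 /\ d i = k)
    & forall i, {in B1, forall b, s i <> Some b ->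
        mdvd (form_poly b) (vf (row i M) b)}].

(** On [b = 0], row [i] applied to [b] is a constant [c i] times [q], nonzero only if [d i = k],
    because [q] has degree at least [k] and the row at most [k]. An unmarked row [i0] transverse to
    [b] at [x] has [c i0 != 0], and its multiples clear the other constants. Being unmarked, it is
    tangent to all of [B1], so tangency obtained earlier survives. *)
Lemma addition_step B1 M s b :
  addition_state B1 M s -> b \notin B1 -> free (b :: B1) ->
  {in b :: B1, forall c : form, c x = 0} -> addition_bound b ->
  exists M' s', addition_state (b :: B1) M' s'.
Proof.
move=> [[ML Md] Mu cs sB sd] bB bfree Bx [p [q [e [bp qe ke qb]]]].
pose J := [set i | isSome (s i)].
have [i0 i0J i0b] : exists2 i, i \notin J & evalv x (vf (row i M) b) != 0.
  apply: (exists_transverse_row Mu bfree cs) => i iJ c cB.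
  have [|g ->] := sd i c cB; first by move=> sc; rewrite inE sc in iJ.
  by rewrite rmorphM /= evalv_form Bx ?mul0r // inE cB orbT.
have si0 : s i0 = None by move: i0J; rewrite inE; case: (s i0).
set pi := pullback (proj_along b p) in qb.
have /fin_all_exists[c cE] i : exists c : K,
    pi (vf (row i M) b) = c *: q /\ (c != 0 -> d i = k).
  have Rd : pi (vf (row i M) b) \is (d i).-homog.
    by apply/pullback_homog/vf_homog => j; rewrite mxE.
  have [R0|Rn0] := eqVneq (pi (vf (row i M) b)) 0.
    by exists 0; rewrite R0 scale0r eqxx.
  have ed := dhomog_dvd_leq Rn0 Rd qe (qb _ (ML i)).
  have dik : d i = k by apply/eqP; rewrite eqn_leq dk (leq_trans ke).
  have eE : e = d i by apply/eqP; rewrite eqn_leq ed dik ke.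
  rewrite eE in qe; have [c cE] := dhomog_dvd_eq Rd qe (qb _ (ML i)).
  by exists c.
have ci0 : c i0 != 0.
  apply: contraNneq i0b => ci0; have [E _] := cE i0.
  have <- : evalv x (pi (vf (row i0 M) b)) = evalv x (vf (row i0 M) b).
    by rewrite evalv_pullback proj_alongE Bx ?mem_head // scale0r subr0.
  by rewrite E ci0 scale0r rmorph0.
pose t : 'cV[K]_n := \col_i (if i == i0 then 0 else c i / c i0).
have tE i : t i 0 = if i == i0 then 0 else c i / c i0 by rewrite mxE.
clearbody t.
pose T : 'M[K]_n := 1%:M - t *m delta_mx 0 i0.
(* As [t] vanishes at [i0], the matrix [t *m delta_mx 0 i0] has square zero. *)
have Tu : T \in unitmx.
  have : T *m (1%:M + t *m delta_mx 0 i0) = 1%:M.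
    rewrite /T mulmxDr mulmx1 mulmxBl mul1mx addrA subrK.
    rewrite mulmxA -(mulmxA t) -rowE.
    have -> : row i0 t = 0 by apply/matrixP => i j; rewrite !mxE [j]ord1 tE eqxx.
    by rewrite mulmx0 mul0mx subr0.
  by case/mulmx1_unit.
pose M' : 'M[S]_n := map_mx (@mpolyC n K) T *m M.
have rowM' i : row i M' = row i M - (t i 0)%:MP *: row i0 M.
  rewrite /M' row_mul /T; apply/rowP => j; rewrite !mxE.
  have E l : (row i (map_mx (@mpolyC n K) T)) 0 l * M l j =
      (i == l)%:R * M l j - (l == i0)%:R * ((t i 0)%:MP * M i0 j).
    rewrite !mxE big_ord1 !mxE eqxx /= mpolyCB mulrBl mpolyCM !mpolyC_nat.
    congr (_ - _); case: (eqVneq l i0) => [->|_].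
      by rewrite mul1r mulr1.
    by rewrite mulr0 !mul0r.
  under eq_bigr do rewrite E.
  rewrite sumrB (bigD1 i) //= eqxx mul1r big1 => [|l li]; last first.
    by rewrite eq_sym (negPf li) mul0r.
  rewrite addr0 (bigD1 i0) //= eqxx mul1r big1 ?addr0 // => l /negPf ->.
  by rewrite mul0r.
pose s' i := if i == i0 then Some b else s i.
exists M', s'; split.
- split=> [i a aA|i j].
    rewrite rowM' -scaleNr -rmorphN vfDl vfZl.
    by apply: mdvdD; [|apply: mdvdMr]; apply: ML.
  have := congr1 (fun u : 'rV_n => u 0 j) (rowM' i); rewrite !mxE => ->.
  apply: rpredB => //; rewrite mul_mpolyC tE; case: (eqVneq i i0) => [_|_].
    by rewrite scale0r rpred0.
  have [->|cn0] := eqVneq (c i) 0; first by rewrite mul0r scale0r rpred0.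
  have [_ /(_ cn0) ->] := cE i; have [_ /(_ ci0) <-] := cE i0.
  exact: rpredZ.
- rewrite map_mxM -map_mx_comp (_ : map_mx _ T = T) ?unitmx_mul ?Tu //.
  by apply/matrixP => i j; rewrite !mxE /= /evalv mevalC.
- rewrite (cardsD1 i0) inE {1}/s' eqxx add1n /= -cs; congr _.+1.
  apply: eq_card => i; rewrite !inE /s'; case: eqVneq => [->|//].
  by rewrite si0.
- move=> i a; rewrite /s'; case: eqVneq => [-> [<-]|_ /sB[aB ->]].
    by rewrite mem_head; have [_ ->] := cE i0.
  by rewrite inE aB orbT.
- move=> i a; rewrite inE => /orP[/eqP ->|aB]; rewrite /s'.
    case: eqVneq => [_ //|ii0 _].
    apply/(pullback_proj_eq0 _ bp); rewrite rowM' -scaleNr -rmorphN vfDl vfZl.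
    rewrite rmorphD rmorphM /= -/pi /= [pi _%:MP]comp_mpolyC.
    have [-> _] := cE i; have [-> _] := cE i0.
    rewrite mul_mpolyC scalerA -scalerDl tE (negPf ii0).
    by rewrite mulNr divfK // subrr scale0r.
  move=> sia; rewrite rowM' -scaleNr -rmorphN vfDl vfZl.
  apply: mdvdD; last by apply/mdvdMr/sd => //; rewrite si0.
  apply: sd => // sa; apply: sia; case: eqVneq => [ii0|//].
  by rewrite ii0 si0 in sa.
Qed.

Lemma addition_steps B M : log_matrix A d M -> map_mx (evalv x) M \in unitmx ->
  free B -> {in B, forall b : form, b x = 0} -> {in B, forall b, addition_bound b} ->
  exists M' s', addition_state B M' s'.
Proof.
move=> ML Mu; elim: B => [|b B IHB] Bfree Bx Bb.
  exists M, (fun=> None); split=> //.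
  by apply/eqP; rewrite cards_eq0; apply/eqP/setP => i; rewrite !inE.
have /andP[bB Bf] : (b \notin B) && free B.
  have := Bfree; rewrite free_cons => /andP[bB ->]; rewrite andbT.
  by apply: contra bB; apply: memv_span.
have [c cB|c cB|M' [s' st]] := IHB Bf.
- by apply: Bx; rewrite inE cB orbT.
- by apply: Bb; rewrite inE cB orbT.
by apply: (addition_step st) => //; apply: Bb; rewrite mem_head.
Qed.

(** Each marked row is multiplied by the one form to which it may fail to be tangent. In [d'] the
    option [s i] is coerced to 0 or 1, and there are as many marks as new forms, so the degree sum
    stays the one required by Saito's criterion. *)
Lemma addition_matrix B M s : addition_state B M s -> \det M != 0 ->
  0 \notin B -> (\sum_i d i)%N = size A ->
  let d' i := (d i + s i)%N in
  let M' := \matrix_i (oapp (@form_poly K V) 1 (s i) *: row i M) in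
  [/\ log_matrix (A ++ B) d' M', (\sum_i d' i)%N = size (A ++ B) & \det M' != 0].
Proof.
move=> [[ML Md] Mu cs sB sd] Mn0 B0 dA; split.
- split=> [i a|i j].
    rewrite rowK vfZl mem_cat => /orP[aA|aB].
      by apply/mdvdMr/ML.
    have [->|/eqP sia] := eqVneq (s i) (Some a).
      by apply: mdvdMl; exists 1; rewrite mulr1.
    by apply/mdvdMr/sd.
  rewrite !mxE addnC; apply: dhomogM => //; case: (s i) => [a|] /=.
    exact: form_poly_homog.
  exact: dhomog1.
- rewrite big_split /= dA size_cat; congr (_ + _)%N.
  rewrite -cs -sum1dep_card [RHS]big_mkcond /=; apply: eq_bigr => i _.
  by case: (s i).
- have -> : \matrix_i (oapp (@form_poly K V) 1 (s i) *: row i M) =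
     diag_mx (\row_i oapp (@form_poly K V) 1 (s i)) *m M.
    by apply/matrixP => i j; rewrite mul_diag_mx !mxE.
  rewrite det_mulmx det_diag mulf_neq0 //.
  elim/big_ind: _ => [|u v un0 vn0|i _]; first exact: oner_neq0.
    exact: mulf_neq0.
  rewrite mxE; case si: (s i) => [a|] /=; last exact: oner_neq0.
  apply: form_poly_neq0; apply: contraNneq B0 => <-.
  by have [] := sB _ _ si.
Qed.

End MultipleAddition.

(** * Weyl arrangements *)

Section Avoidance.
Variables (R : realType) (V : vectType R).
Local Notation form := ('Hom(V, R^o)).
Implicit Types (a b : form) (A B : seq form) (x : V).

(** Double annihilator. If a common zero [p] of [B] is not a zero of [b], projection along [p] shows
    that [a], less the multiple of [b] with the same value at [p], vanishes wherever [B] does. *)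
Lemma vanishing_span B a :
  (forall x, {in B, forall b : form, b x = 0} -> a x = 0) -> a \in <<B>>%VS.
Proof.
elim: B a => [|b B IHB] a aB.
  rewrite (_ : a = 0) ?mem0v //; apply/lfunP => x; rewrite aB ?lfunE //.
have [bB|] := pselect (forall x, {in B, forall c : form, c x = 0} -> b x = 0).
  apply: (subvP (sub_span (X := B) _)).
    by move=> c cB; rewrite inE cB orbT.
  apply: IHB => x xB; apply: aB => c; rewrite inE => /orP[/eqP -> |/xB //].
  exact: bB.
move/existsNP => [p /not_implyP[pB /eqP bp]].
rewrite span_cons.
have -> : a = (a p / b p : R) *: b + (a - (a p / b p : R) *: b).
  by rewrite addrC subrK.
apply: memv_add; first exact/memvZ/memv_line.
apply: IHB => x xB; rewrite add_lfunE opp_lfunE scale_lfunE.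
have : a (x - (b x / b p : R) *: p) = 0.
  apply: aB => c; rewrite inE linearB linearZ /= => /orP[/eqP ->|cB].
    by rewrite [X in _ - X]mulfVK // subrr.
    by rewrite (xB c cB) (pB c cB) scaler0 subr0.
rewrite linearB linearZ /= => /eqP; rewrite subr_eq0 => /eqP ->.
by rewrite /GRing.scale /= mulrAC [X in _ - X]mulrAC [a p * _]mulrC subrr.
Qed.

Lemma exists_notin (s : seq R) : exists t, t \notin s.
Proof.
exists (1 + \sum_(z <- s) `|z|); apply/negP => ts.
have : \sum_(z <- s) `|z| < 1 + \sum_(z <- s) `|z| by rewrite ltrDr ltr01.
apply/negP; rewrite -leNgt; set t := 1 + _ in ts *.
rewrite (le_trans (ler_norm t)) // (big_rem t ts) /= lerDl.
by apply: sumr_ge0 => z _; apply: normr_ge0.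
Qed.

(** On a line [x + t *: y] inside the common zeros of [B], with [x] good for [A] and [y] good for
    [a], each form excludes at most one value of [t]. *)
Lemma avoiding_point A B : {in A, forall a : form, a \notin <<B>>%VS} ->
  exists x, {in B, forall b : form, b x = 0} /\ {in A, forall a : form, a x != 0}.
Proof.
elim: A => [|a A IHA] AB.
  by exists 0; split=> // b _; rewrite linear0.
have [c cA|x [xB xA]] := IHA; first by apply: AB; rewrite inE cA orbT.
have [y [yB ay]] : exists y, {in B, forall b : form, b y = 0} /\ a y != 0.
  apply: contrapT => ny; have /negP := AB a (mem_head _ _); apply.
  apply: vanishing_span => y yB; apply/eqP/negPn/negP => ay.
  by apply: ny; exists y.
have [t] := exists_notin [seq - (c x / c y : R) | c : form <- a :: A].
move=> tn; exists (x + t *: y); split=> [b bB|c cA].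
  by rewrite linearD linearZ /= (xB b bB) (yB b bB) scaler0 addr0.
rewrite linearD linearZ /=; apply: contraNneq tn => cxy.
have cy : c y != 0.
  move: cA; rewrite inE => /orP[/eqP ->//|cA].
  by apply: contraTneq (xA c cA) => cy; rewrite cy scaler0 addr0 in cxy; rewrite cxy eqxx.
apply/mapP; exists c => //.
have {}cxy : (c x : R) = - (t * (c y : R)).
  by apply/eqP; rewrite -subr_eq0 opprK; apply/eqP.
by rewrite cxy mulNr opprK mulfK.
Qed.

End Avoidance.

(** * The invariant form and coroots *)

Section InvariantForm.
Variables (R : realType) (V : vectType R).
Local Notation form := ('Hom(V, R^o)).
Variable Phi : {fset form}.
Hypothesis PhiR : root_system Phi.
Implicit Types (a b : form) (u v w : V).

(** The canonical invariant form: reflections permute the summands, and it is definite because the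
    roots span the dual. *)
Definition trace_form u w : R := \sum_(a <- Phi) (a u : R) * (a w : R).

Lemma root_form_neq0 u : u != 0 -> exists2 a, a \in Phi & a u != 0.
Proof.
move=> u0; apply: contrapT => nPhi; case/eqP: u0.
have all0 a : a u = 0.
  have [_ PhiS _] := PhiR.
  have : a \in <<Phi>>%VS by rewrite PhiS memvf.
  move/(@coord_span _ _ _ (in_tuple Phi)) => ->.
  rewrite sum_lfunE; apply: big1 => i _; rewrite scale_lfunE.
  have [->|au] := eqVneq ((Phi : seq form)`_i u) 0; first by rewrite scaler0.
  by case: nPhi; exists (Phi : seq form)`_i => //; apply: mem_nth.
rewrite (coord_vbasis (memvf u)); apply: big1 => i _.
have := all0 (coordf i); rewrite lfunE /= => ->.
by rewrite scale0r.
Qed.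

Lemma trace_form_gt0 u : u != 0 -> 0 < trace_form u u.
Proof.
move=> /root_form_neq0[a aP au]; rewrite /trace_form (bigD1_seq a) //=.
rewrite ltr_wpDr //; last by rewrite -expr2 exprn_even_gt0.
by apply: sumr_ge0 => b _; rewrite -expr2 sqr_ge0.
Qed.

Lemma trace_formC u w : trace_form u w = trace_form w u.
Proof. by apply: eq_bigr => a _; apply: mulrC. Qed.

(* The form is invariant under the reflection in [a], which permutes [Phi]. *)
Lemma trace_form_coroot a v u : is_coroot Phi a v ->
  2 * trace_form v u = (a u : R) * trace_form v v.
Proof.
move=> [av ra].
pose s b := b - (b v : R) *: a.
have sK : involutive s.
  move=> b; rewrite /s add_lfunE opp_lfunE scale_lfunE av.
  rewrite -[RHS]subr0 -addrA -opprD -scalerDl; congr (_ - _).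
  rewrite (_ : _ + _ = 0) ?scale0r // /GRing.scale /=; ring.
have sP : perm_eq (map s Phi) Phi.
  have uS : uniq (map s Phi) by rewrite map_inj_uniq ?fset_uniq //; apply: inv_inj.
  apply: uniq_perm; rewrite ?fset_uniq //.
  suff subP : {subset map s Phi <= (Phi : seq form)}.
    exact: (uniq_min_size uS subP (eq_leq (esym (size_map s Phi)))).2.
  by move=> _ /mapP[b bP ->]; apply: ra.
have inv x y : trace_form (x - (a x : R) *: v) (y - (a y : R) *: v) = trace_form x y.
  rewrite {2}/trace_form -(perm_big _ sP) /= big_map; apply: eq_bigr => b _.
  rewrite /s !add_lfunE !opp_lfunE !scale_lfunE !linearB !linearZ /=.
  rewrite /GRing.scale /=; ring.
have := inv v u; rewrite av.
have -> : trace_form (v - 2 *: v) (u - (a u : R) *: v) =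
    - trace_form v u + (a u : R) * trace_form v v.
  rewrite /trace_form mulr_sumr -sumrN -big_split; apply: eq_bigr => b _ /=.
  rewrite !linearB !linearZ /= /GRing.scale /=; ring.
lra.
Qed.

Lemma flat_is_linear :
  linear (fun u : V => \sum_(a <- Phi) (a u : R) *: a : form).
Proof.
move=> t u w; rewrite scaler_sumr -big_split; apply: eq_bigr => a _ /=.
by rewrite linearP scalerDl scalerA.
Qed.

Definition flat_fun (u : V) : form := \sum_(a <- Phi) (a u : R) *: a.
HB.instance Definition _ := GRing.isLinear.Build R V form *:%R flat_fun flat_is_linear.

Definition flat : 'Hom(V, form) := linfun flat_fun.

Lemma flatE u w : flat u w = trace_form u w.
Proof.
rewrite /flat lfunE /= /flat_fun sum_lfunE; apply: eq_bigr => a _.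
by rewrite scale_lfunE.
Qed.

Lemma flat_surj a : a \in limg flat.
Proof.
have ker0 : lker flat = 0%VS.
  apply/eqP; rewrite -subv0; apply/subvP => u; rewrite memv_ker memv0 => /eqP fu.
  apply/negPn/negP => /trace_form_gt0; rewrite -flatE fu lfunE /=.
  by rewrite ltxx.
have : (limg flat == fullv)%VS.
  rewrite eqEdim subvf /=; have := limg_ker_dim flat fullv.
  rewrite capfv ker0 dimv0 add0n => ->.
  by rewrite !dimvf /= /dim /= muln1.
by move/eqP ->; apply: memvf.
Qed.

(** The form [trace_form] carried over to the dual by the isomorphism [flat]. *)
Definition root_dot a b : R := a ((flat^-1)%VF b).

Lemma root_dot_flat a w : root_dot a (flat w) = a w.
Proof.
rewrite /root_dot; have := limg_lfunVK (flat_surj (flat w)).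
set w' := (flat^-1)%VF _ => ww.
suff -> : w' = w by [].
apply/eqP; rewrite -subr_eq0; apply/negPn/negP => /trace_form_gt0.
by rewrite -flatE [flat (_ - _)]linearB /= ww subrr lfunE /= ltxx.
Qed.

Lemma flat_ex a : exists w, a = flat w.
Proof. by exists ((flat^-1)%VF a); rewrite limg_lfunVK ?flat_surj. Qed.

Lemma root_dotC a b : root_dot a b = root_dot b a.
Proof.
have [u ->] := flat_ex a; have [w ->] := flat_ex b.
by rewrite !root_dot_flat !flatE trace_formC.
Qed.

Lemma root_dotP (t : R) a b c : root_dot (t *: a + b) c = t * root_dot a c + root_dot b c.
Proof. by rewrite /root_dot add_lfunE scale_lfunE. Qed.

Lemma root_dot_gt0 a : a != 0 -> 0 < root_dot a a.
Proof.
have [u ->] := flat_ex a => fu; rewrite root_dot_flat flatE.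
by apply: trace_form_gt0; apply: contraNneq fu => ->; rewrite linear0.
Qed.

(** By [trace_form_coroot], [a] is [2 / trace_form v v] times [flat v], so the normalised product
    with [a] is evaluation at [v]. *)
Lemma pair_coroot a b v : is_coroot Phi a v -> pair root_dot b a = b v.
Proof.
move=> av; have v0 : v != 0.
  case: av => av _; apply: contra_eq_neq av => ->; rewrite linear0 eq_sym.
  by rewrite (_ : (2 : R^o) != 0) ?pnatr_eq0.
have vv := trace_form_gt0 v0; have vvn := lt0r_neq0 vv.
have aE : a = (2 / trace_form v v : R) *: flat v.
  apply/lfunP => u; rewrite scale_lfunE flatE.
  have := trace_form_coroot u av.
  rewrite {1}/GRing.scale /= => e; rewrite mulrAC e mulfK //.
have dotE c : root_dot c a = 2 / trace_form v v * (c v : R).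
  rewrite root_dotC {1}aE -[_ *: _]addr0 root_dotP.
  rewrite root_dotC root_dot_flat /root_dot lfunE /= addr0 //.
rewrite /pair !dotE; have -> : a v = 2 by case: av.
field; exact: vvn.
Qed.

Lemma root_system_rootset : crystallographic Phi -> reduced Phi ->
  rootset root_dot Phi.
Proof.
move=> Phic Phir; have [P0 _ PhiC] := PhiR; split=> //.
- move=> a b aP bP; have [v av] := PhiC a aP.
  by rewrite /refl (pair_coroot _ av); case: av => _; apply.
- move=> a b aP bP; have [v av] := PhiC a aP.
  by rewrite (pair_coroot _ av); apply: Phic av.
- by move=> a aP t taP; apply: Phir taP.
Qed.

End InvariantForm.

(** * Freeness of the height filtration *)

Section HeightFiltration.
Variables (R : realType) (V : vectType R).
Local Notation form := ('Hom(V, R^o)).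
Local Notation n := (\dim {:V}).
Variable dot : form -> form -> R.
Hypothesis dotC : forall x y, dot x y = dot y x.
Hypothesis dotP : forall (t : R) x y z, dot (t *: x + y) z = t * dot x z + dot y z.
Hypothesis dot_gt0 : forall x, x != 0 -> 0 < dot x x.
Variables (Phi : {fset form}) (h : form -> R).
Hypotheses (PhiR : rootset dot Phi) (hl : functional h).
Hypothesis hn0 : {in Phi, forall a, h a != 0}.
Hypothesis hE : forall x, twice_height dot Phi h x = 2 * h x.
Implicit Types (a b : form).

(** Heights of positive roots are positive integers, so this means height at most [k]. The strict
    bound makes the list coincide with [low] at a root of height [k.+1]. *)
Definition below k : seq form := [seq a <- Phi | 0 < h a < k.+1%:R].

Lemma height_nat a : a \in Phi -> 0 < h a -> exists m, h a = m.+1%:R.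
Proof.
move=> aP ha; have [m] := twice_height_nat dotC dotP dot_gt0 PhiR hl hn0 aP ha.
by rewrite hE => e; exists m; lra.
Qed.

Lemma belowE k b : h b = k.+1%:R -> below k = low Phi h b.
Proof. by move=> hb; rewrite /low hb. Qed.

Lemma positive_nonparallel (P : pred form) : (forall a, P a -> 0 < h a) ->
  nonparallel [seq a <- Phi | P a].
Proof.
move=> Ph; have [P0 _ _ Pd] := PhiR; split.
- by rewrite filter_uniq ?fset_uniq.
- by rewrite mem_filter (negPf P0) andbF.
move=> a b; rewrite !mem_filter => /andP[/Ph ha aP] /andP[/Ph hb bP] t at0.
move: ha; rewrite at0 in aP *; case: (Pd b bP t aP) => ->; first by rewrite scale1r.
by rewrite scaleN1r functionalN // oppr_gt0 ltNge ltW.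
Qed.

Lemma below_mem k a : a \in below k -> [/\ a \in Phi, 0 < h a & h a < k.+1%:R].
Proof. by rewrite mem_filter => /andP[/andP[]]. Qed.

Lemma below_nonparallel k : nonparallel (below k).
Proof. by apply: positive_nonparallel => a /andP[]. Qed.

Lemma below_step k : perm_eq (below k.+1) (below k ++ [seq a <- Phi | h a == k.+1%:R]).
Proof.
apply: uniq_perm => [||a].
- by rewrite filter_uniq ?fset_uniq.
- rewrite cat_uniq !filter_uniq ?fset_uniq //= andbT; apply/hasPn => a.
  rewrite !mem_filter => /andP[/eqP -> _]; by rewrite ltxx andbF.
rewrite mem_cat !mem_filter -andb_orl.
have [aP|] := boolP (a \in Phi); last by rewrite !andbF.
rewrite !andbT; have [ha|ha] := ltP 0 (h a); last first.
  by apply/esym/eqP => ha'; move: ha; rewrite ha' leNgt ltr0n.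
have [m ->] := height_nat aP ha.
by rewrite /= !ltr_nat eqr_nat ltnS leq_eqVlt orbC.
Qed.

Lemma root_addition_bound k b : b \in Phi -> h b = k.+1%:R ->
  exists p, b p = 1 /\ exists e,
   [/\ addition_poly (below k) b p (rep Phi h b) \is e.-homog, (k <= e)%N,
       e = count (fun a => rep Phi h b a != a) (below k) &
       forall th, logv (below k) th ->
       mdvd (addition_poly (below k) b p (rep Phi h b))
         (pullback (proj_along b p) (vf th b))].
Proof.
move=> bP hbk; have hb : 0 < h b by rewrite hbk ltr0n.
have [P0 _ _ _] := PhiR.
have [p bp] : exists p, b p = 1.
  by apply: form_neq0_point; apply: contraNneq P0 => <-.
exists p; split=> //; exists (count (fun a => rep Phi h b a != a) (below k)).
rewrite (belowE hbk); split=> //.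
- exact: addition_poly_homog.
- exact: (count_rep dotC dotP dot_gt0 PhiR hl hn0 hE bP hb hbk).
move=> th thL; apply: addition_poly_dvd thL => //.
- by rewrite -(belowE hbk); apply: below_nonparallel.
- by move=> a /lowP[aP ha _ ab] t; apply: (not_parallel PhiR hl bP hb).
- by move=> a /repP[].
- by move=> a; apply: rep_span.
- by move=> a c al cl s t; apply: (rep_class PhiR hl bP hb al cl).
Qed.

Definition free_below k (d : 'I_n -> nat) M :=
  [/\ log_matrix (below k) d M, (\sum_i d i)%N = size (below k), \det M != 0
    & forall i, (d i <= k)%N].

Lemma free_below_exists k : exists d M, free_below k d M.
Proof.
elim: k => [|k [d [M [ML dA Mn0 dk]]]].
  have b0 : below 0 = [::].
    apply/eqP; rewrite -size_eq0 size_filter -leqn0 leqNgt -has_count.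
    apply/hasPn => a aP; apply/negP => /andP[ha].
    by have [m ->] := height_nat aP ha; rewrite ltr_nat.
  exists (fun=> 0%N), 1%:M; split=> //.
  - split=> [i a|i j]; first by rewrite b0.
    by rewrite mxE; case: (i == j); rewrite ?rpred0 // dhomog1.
  - by rewrite b0 big1.
  - by rewrite det1 oner_neq0.
pose B := [seq a <- Phi | h a == k.+1%:R].
have BP b : b \in B -> b \in Phi /\ h b = k.+1%:R.
  by rewrite mem_filter => /andP[/eqP].
have [|x [xB xA]] := @avoiding_point _ _ (below k) B.
  move=> a /below_mem[aP ha hak]; apply/negP => aB.
  apply: (no_low_root dotC dotP dot_gt0 PhiR hl hn0 _ aP aB); first by rewrite ltr0n.
  by rewrite ha.
have Bf : free B.
  apply: (obtuse_free dotC dotP dot_gt0 hl).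
  - by rewrite filter_uniq ?fset_uniq.
  - by move=> b /BP[_ ->]; rewrite ltr0n.
  move=> b c /BP[bP hb] /BP[cP hc] bc.
  by apply: (same_height_obtuse dotC dotP dot_gt0 PhiR hl hn0) => //; rewrite hb hc.
have Mu := saito_unit (below_nonparallel k) ML dA Mn0 xA.
have Bb : {in B, forall b, addition_bound (below k) k b}.
  move=> b /BP[bP hb]; have [p [bp [e [qe ke _ qd]]]] := root_addition_bound bP hb.
  by exists p; eexists; exists e; split; [exact: bp|exact: qe|exact: ke|exact: qd].
have [M' [s st]] := addition_steps dk ML Mu Bf xB Bb.
have [ML' Mu' _ sB _] := st.
have Mn0' : \det M' != 0.
  apply: contraTneq Mu' => M0; rewrite unitmxE det_map_mx M0.
  by rewrite rmorph0 unitr0.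
have B0 : 0 \notin B.
  by rewrite mem_filter; have [P0 _ _ _] := PhiR; rewrite (negPf P0) andbF.
have [[L1 L2] dd dn0] := addition_matrix st Mn0' B0 dA.
exists (fun i => d i + s i)%N; eexists; split; last 1 first.
- move=> i; case: (s i) => [b|] /=; last by rewrite addn0 ltnW // ltnS.
  by rewrite addn1 ltnS.
- split; last exact: L2.
  by move=> i a; rewrite (perm_mem (below_step k)); apply: L1.
- by rewrite dd; apply/esym/perm_size/below_step.
- exact: dn0.
Qed.

End HeightFiltration.

(** * Restriction to a hyperplane *)

Section RestrictionToHyperplane.
Variables (K : fieldType) (V : vectType K).
Local Notation form := ('Hom(V, K^o)).
Local Notation n := (\dim {:V}).
Local Notation S := (symdual V).
Variable h : form.
Local Notation H := (lker h).
Local Notation W := (subvs_of H).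
Implicit Types (a b : form) (th : 'rV[S]_n) (l : 'Hom(W, K^o)).

Definition incl : 'Hom(W, V) := linfun vsval.
Definition retr : 'Hom(V, W) := linfun (vsproj H).

Lemma inclE (w : W) : incl w = vsval w. Proof. by rewrite lfunE. Qed.

Lemma retrK v : v \in H -> incl (retr v) = v.
Proof. by move=> vH; rewrite !lfunE /= vsprojK. Qed.

Lemma inclK w : retr (incl w) = w.
Proof. by rewrite !lfunE /= vsvalK. Qed.

Definition res_form a : 'Hom(W, K^o) := (a \o incl)%VF.

Lemma res_formE a w : res_form a w = a (vsval w).
Proof. by rewrite lfunE /= inclE. Qed.

Lemma res_form_h : res_form h = 0.
Proof.
apply/lfunP => w; rewrite res_formE lfunE /=; apply/eqP.
by rewrite -memv_ker subvsP.
Qed.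

Lemma res_formD a b : res_form (a + b) = res_form a + res_form b.
Proof. by apply/lfunP => w; rewrite add_lfunE !res_formE add_lfunE. Qed.

Lemma res_formZ (t : K) a : res_form (t *: a) = t *: res_form a.
Proof. by apply/lfunP => w; rewrite scale_lfunE !res_formE scale_lfunE. Qed.

Lemma res_form_eq0 a : res_form a = 0 -> exists t : K, a = t *: h.
Proof.
move=> a0; apply: lker_sub_scale; apply/subvP => v vH.
have := congr1 (fun g : 'Hom(W, K^o) => g (retr v)) a0.
by rewrite res_formE -inclE retrK // lfunE memv_ker /= => ->.
Qed.

Lemma trace_on_lker a : trace_on H (lker a) = lker (res_form a).
Proof.
by apply/vspaceP => w; rewrite -memv_preim !memv_ker res_formE lfunE.
Qed.

(** Coordinates of the hyperplane are extended to [V] through the retraction. For a tangent field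
    the choice of extension is immaterial, by [vf_res_tangent]. *)
Definition res_vf th : 'rV[symdual W]_(\dim {:W}) :=
  \row_j pullback incl (vf th (coordf j \o retr)%VF).

Lemma form_coord l : l = \sum_(j < \dim {:W}) (l (vbasis {:W})`_j : K) *: coordf j.
Proof.
apply/lfunP => w; rewrite {1}(coord_vbasis (memvf w)) linear_sum sum_lfunE.
apply: eq_bigr => j _; rewrite linearZ scale_lfunE lfunE /=.
exact: mulrC.
Qed.

Lemma vf_res th l : vf (res_vf th) l = pullback incl (vf th (l \o retr)%VF).
Proof.
have -> : (l \o retr)%VF =
    \sum_(j < \dim {:W}) (l (vbasis {:W})`_j : K) *: (coordf j \o retr)%VF.
  apply/lfunP => v; rewrite lfunE /= {1}(form_coord l) !sum_lfunE.
  by apply: eq_bigr => j _; rewrite !scale_lfunE comp_lfunE.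
rewrite /vf; under eq_bigr do rewrite mxE.
rewrite -/(vf th _) vf_lincomb rmorph_sum /=.
by apply: eq_bigr => j _; rewrite pullbackZ.
Qed.

(** Two extensions of a form differ by a multiple of [h], on which a tangent field has a value that
    vanishes on the hyperplane. *)
Lemma vf_res_tangent th a : mdvd (form_poly h) (vf th h) ->
  vf (res_vf th) (res_form a) = pullback incl (vf th a).
Proof.
move=> [g gE]; rewrite vf_res.
have [t aE] : exists t : K, a - (res_form a \o retr)%VF = t *: h.
  apply: res_form_eq0; apply/lfunP => w.
  rewrite res_formE add_lfunE opp_lfunE [X in _ - X]comp_lfunE -inclE inclK.
  by rewrite res_formE inclE subrr lfunE.
have -> : (res_form a \o retr)%VF = a + (- t) *: h.
  by rewrite scaleNr -aE opprB addrC subrK.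
rewrite vfD vfZ gE rmorphD /= pullbackZ rmorphM /= pullback_form.
by rewrite -/(res_form h) res_form_h form_poly0 mul0r scaler0 addr0.
Qed.

Lemma res_vf_homog d th : (forall j, th 0 j \is d.-homog) ->
  forall j, res_vf th 0 j \is d.-homog.
Proof. by move=> thd j; rewrite mxE; apply/pullback_homog/vf_homog. Qed.

Lemma dim_lker : h != 0 -> (\dim {:W}).+1 = n.
Proof.
move=> /form_neq0_point[p hp]; have := limg_ker_dim h fullv; rewrite capfv => <-.
have -> : \dim (limg h) = 1%N.
  apply/eqP; rewrite eqn_leq; apply/andP; split.
    by apply: leq_trans (dimvS (subvf _)) _; rewrite dimvf.
  rewrite lt0n dimv_eq0; apply: contraTneq (memv_img h (memvf p)) => ->.
  by rewrite memv0 hp oner_eq0.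
by rewrite addn1 dimvf.
Qed.

End RestrictionToHyperplane.

(** * The last addition and the restriction *)

Section TopStep.
Variables (R : realType) (V : vectType R).
Local Notation form := ('Hom(V, R^o)).
Local Notation n := (\dim {:V}).
Variable dot : form -> form -> R.
Hypothesis dotC : forall x y, dot x y = dot y x.
Hypothesis dotP : forall (t : R) x y z, dot (t *: x + y) z = t * dot x z + dot y z.
Hypothesis dot_gt0 : forall x, x != 0 -> 0 < dot x x.
Variables (Phi : {fset form}) (h : form -> R).
Hypotheses (PhiR : rootset dot Phi) (hl : functional h).
Hypothesis hn0 : {in Phi, forall a, h a != 0}.
Hypothesis hE : forall x, twice_height dot Phi h x = 2 * h x.
Variables (theta : form) (m : nat).
Hypotheses (thP : theta \in Phi) (hth : h theta = m.+1%:R).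
Implicit Types (a b : form).

(** Both stages are kept: [M], before row [i0] is multiplied by [theta], supplies the fields to be
    restricted; [M'], after it, supplies degrees to compare with the given exponents. *)
Lemma top_step : exists (d : 'I_n -> nat) (M : 'M[symdual V]_n) (i0 : 'I_n) (x : V),
  [/\ log_matrix (below Phi h m) d M,
      forall i, i != i0 -> mdvd (form_poly theta) (vf (row i M) theta),
      theta x = 0 /\ map_mx (evalv x) M \in unitmx,
      [/\ forall i, (d i <= m)%N, d i0 = m & (\sum_i d i)%N = size (below Phi h m)]
    & count (fun a => rep Phi h theta a != a) (below Phi h m) = m /\
      exists M' : 'M[symdual V]_n,
      let d' i := (d i + (i == i0))%N in let F := below Phi h m ++ [:: theta] in
      [/\ log_matrix F d' M', (\sum_i d' i)%N = size F & \det M' != 0]].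
Proof.
have [d [M [ML dA Mn0 dm]]] := free_below_exists dotC dotP dot_gt0 PhiR hl hn0 hE m.
have hth0 : 0 < h theta by rewrite hth ltr0n.
have th0 : theta != 0 by have [P0 _ _ _] := PhiR; apply: contraNneq P0 => <-.
have bE := belowE Phi hth.
have [|x [xB xA]] := @avoiding_point _ _ (below Phi h m) [:: theta].
  move=> a; rewrite bE => /lowP[aP ha _ ab]; rewrite span_seq1.
  by apply/vlineP => -[t]; apply: (not_parallel PhiR hl thP hth0).
have thx : theta x = 0 by apply: xB; rewrite mem_head.
have Mu := saito_unit (below_nonparallel PhiR hl m) ML dA Mn0 xA.
have [p [thp [e [qe me eE qd]]]] :=
  root_addition_bound dotC dotP dot_gt0 PhiR hl hn0 hE thP hth.
have tfree : free [:: theta] by rewrite seq1_free.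
have Bb : {in [:: theta], forall b, addition_bound (below Phi h m) m b}.
  move=> b; rewrite inE => /eqP ->; exists p; eexists; exists e.
  by split; [exact: thp|exact: qe|exact: me|exact: qd].
have [M' [s [ML' Mu' cs sB sd]]] := addition_steps dm ML Mu tfree xB Bb.
have /eqP/cards1P[i0 i0E] := cs.
have si0 : s i0 = Some theta.
  have : i0 \in [set i | isSome (s i)] by rewrite i0E set11.
  rewrite inE; case si : (s i0) => [b|//] _.
  by have [] := sB _ _ si; rewrite inE => /eqP ->.
have [_ di0] := sB _ _ si0.
exists d, M', i0, x; split=> //; last split; last first.
- have Mn0' : \det M' != 0.
    apply: contraTneq Mu' => M0; rewrite unitmxE det_map_mx M0.
    by rewrite rmorph0 unitr0.
  have B0 : 0 \notin [:: theta] by rewrite inE eq_sym.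
  have st : addition_state (below Phi h m) m x d [:: theta] M' s by split.
  have [L D N] := addition_matrix st Mn0' B0 dA.
  have sE i : s i = (i == i0) :> bool.
    have : (i \in [set i | isSome (s i)]) = (i == i0) by rewrite i0E inE.
    by rewrite inE.
  exists (\matrix_i (oapp (@form_poly R V) 1 (s i) *: row i M')); split=> //.
    by have [L1 L2] := L; split=> // i j; rewrite -sE.
  by rewrite -D; apply: eq_bigr => i _; rewrite -sE.
(* Row [i0] cannot vanish on [theta] at [x], since the other rows do and the matrix is invertible
   there. Its restriction is thus nonzero of degree [m], and the addition polynomial divides it. *)
- rewrite -eE; apply/eqP; rewrite eqn_leq me andbT -di0.
  set P := pullback (proj_along theta p) in qd.
  have evP : evalv x (P (vf (row i0 M') theta)) = evalv x (vf (row i0 M') theta).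
    by rewrite evalv_pullback proj_alongE thx scale0r subr0.
  have Pn0 : P (vf (row i0 M') theta) != 0.
    apply: contraNneq th0 => P0; rewrite P0 rmorph0 in evP.
    apply/eqP/(evalv_vf_unit Mu') => i; have [->//|ii0] := eqVneq i i0.
    have [||g ->] := sd i theta; rewrite ?mem_head //.
      have : i \notin [set i | isSome (s i)] by rewrite i0E inE.
      by rewrite inE; case: (s i).
    by rewrite rmorphM /= evalv_form thx mul0r.
  apply: (dhomog_dvd_leq Pn0 _ qe); last by apply: qd; have [L _] := ML'.
  apply/pullback_homog/vf_homog => j; rewrite mxE; by have [_ ->] := ML'.
- move=> i ii0; apply: sd; first by rewrite mem_head.
  have : i \notin [set i | isSome (s i)] by rewrite i0E inE.
  by rewrite inE; case: (s i).
Qed.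

Local Notation below_m := (below Phi h m).
Local Notation rp := (rep Phi h theta).

Definition res_forms := [seq res_form theta a | a <- below_m & rp a == a].

Lemma res_form_class a c (t : R) : a \in below_m -> c \in below_m ->
  res_form theta a = t *: res_form theta c -> rp a = rp c.
Proof.
have hth0 : 0 < h theta by rewrite hth ltr0n.
rewrite !(belowE Phi hth) => al cl.
move/eqP; rewrite -subr_eq0 -scaleNr -res_formZ -res_formD => /eqP/res_form_eq0[u uE].
apply: (rep_class PhiR hl thP hth0 (s := t) (t := u) al cl).
by rewrite -uE scaleNr addrCA subrr addr0.
Qed.

Lemma res_form_neq0 a : a \in below_m -> res_form theta a != 0.
Proof.
have hth0 : 0 < h theta by rewrite hth ltr0n.
rewrite (belowE Phi hth) => /lowP[aP ha _ ab]; apply/eqP => /res_form_eq0[t].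
exact: (not_parallel PhiR hl thP hth0).
Qed.

Lemma res_nonparallel : nonparallel res_forms.
Proof.
split.
- rewrite map_inj_in_uniq ?filter_uniq ?fset_uniq // => a c.
  rewrite !(mem_filter (fun a => rp a == a)) => /andP[/eqP ra al] /andP[/eqP rc cl] ac.
  by rewrite -ra -rc; apply: (res_form_class (t := 1)) => //; rewrite scale1r.
- apply/mapP => -[a]; rewrite (mem_filter (fun a => rp a == a)) => /andP[_ al] /eqP.
  by rewrite eq_sym (negPf (res_form_neq0 al)).
move=> _ _ /mapP[a + ->] /mapP[c + ->] t.
rewrite !(mem_filter (fun a => rp a == a)) => /andP[/eqP ra al] /andP[/eqP rc cl].
by move=> /(res_form_class al cl); rewrite ra rc => ->.
Qed.

Lemma res_represents (A : {fset {vspace V}}) :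
  (forall X, X \in A <-> exists2 a, a \in below_m ++ [:: theta] & X = lker a) ->
  represents (restriction A (lker theta)) res_forms.
Proof.
move=> AP; have hth0 : 0 < h theta by rewrite hth ltr0n.
have bE := belowE Phi hth; split=> [X|_ /mapP[a + ->]].
  case/imfsetP => Y /=; rewrite !inE => /andP[Yth /AP[a + YE]] ->.
  rewrite mem_cat inE => /orP[al|/eqP ath]; last by rewrite YE ath eqxx in Yth.
  exists (res_form theta (rp a)).
    apply: map_f; rewrite mem_filter; rewrite bE in al *.
    have [rl _] := repP al; rewrite rl andbT; apply/eqP.
    have [st rE] := rep_span al.
    by rewrite -{1}(rep_class PhiR hl thP hth0 al rl rE).
  rewrite YE trace_on_lker; have al' := al; rewrite bE in al'.
  have [[s t] /= aE] := rep_span al'.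
  have rE : res_form theta a = s *: res_form theta (rp a).
    by rewrite {1}aE res_formD !res_formZ res_form_h scaler0 addr0.
  have s0 : s != 0.
    by apply: contraNneq (res_form_neq0 al) => s0; rewrite rE s0 scale0r.
  by apply/vspaceP => w; rewrite rE !memv_ker scale_lfunE scaler_eq0 (negPf s0).
rewrite (mem_filter (fun a => rp a == a)) => /andP[_ al]; apply/imfsetP.
exists (lker a); last by rewrite trace_on_lker.
rewrite /= !inE; apply/andP; split; last first.
  by apply/AP; exists a; rewrite // mem_cat al.
apply: contraNneq (res_form_neq0 al) => ath.
have /lker_sub_scale[t ->] : (lker theta <= lker a)%VS by rewrite ath.
by rewrite res_formZ res_form_h scaler0.
Qed.

Lemma size_res_forms : count (fun a => rp a != a) below_m = m ->
  (size res_forms + m)%N = size below_m.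
Proof.
move=> cm; rewrite size_map size_filter -[RHS](count_predC (fun a => rp a == a)).
by congr (_ + _)%N; rewrite -[LHS]cm.
Qed.

(** Applied to the restrictions of the coordinate forms of [V], a relation between the restricted
    fields at [x] becomes, by tangency, a relation between rows of the invertible matrix [M] at
    [x]. *)
Lemma res_row_free r (M : 'M[symdual V]_n) (x : V) (k : 'I_r -> 'I_n) :
  injective k -> theta x = 0 -> map_mx (evalv x) M \in unitmx ->
  (forall j, mdvd (form_poly theta) (vf (row (k j) M) theta)) ->
  row_free (evmx (retr theta x) (fun j => res_vf theta (row (k j) M))).
Proof.
move=> kI thx Mu Mth; apply: inj_row_free => w w0.
have xK : incl theta (retr theta x) = x by apply: retrK; rewrite memv_ker thx.
have res0 l : \sum_j w 0 j * evalv (retr theta x)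
    (vf (res_vf theta (row (k j) M)) l) = 0.
  under eq_bigr do rewrite /vf rmorph_sum mulr_sumr.
  rewrite exchange_big /= big1 // => i _.
  transitivity ((l (vbasis {:subvs_of (lker theta)})`_i : R) *
    (w *m evmx (retr theta x) (fun j => res_vf theta (row (k j) M))) 0 i).
    rewrite mxE mulr_sumr; apply: eq_bigr => j _.
    by rewrite evalvZ [X in _ = _ * (_ * X)]mxE mulrCA.
  by rewrite w0 mxE mulr0.
pose w' : 'rV[R]_n := \sum_j w 0 j *: delta_mx 0 (k j).
have w'M : w' *m map_mx (evalv x) M = 0.
  apply/rowP => i; rewrite mulmx_suml summxE mxE.
  rewrite -[RHS](res0 (res_form theta (coordf i))); apply: eq_bigr => j _.
  rewrite vf_res_tangent // evalv_pullback xK vf_coordf.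
  by rewrite -scalemxAl -rowE !mxE.
have w'0 : w' = 0 by rewrite -(mulmxK Mu w') w'M mul0mx.
apply/rowP => j; have := congr1 (fun u : 'rV_n => u 0 (k j)) w'0.
rewrite summxE (bigD1 j) //= !mxE !eqxx mulr1 big1 ?addr0 // => i ij.
rewrite !mxE eqxx /=; case: eqVneq => [/kI ji|]; last by rewrite mulr0.
by rewrite ji eqxx in ij.
Qed.

End TopStep.

Lemma nonparallel_perm (K : fieldType) (V : vectType K) (F G : seq 'Hom(V, K^o)) :
  perm_eq F G -> nonparallel F -> nonparallel G.
Proof.
move=> FG [uF F0 Fp]; split; first by rewrite -(perm_uniq FG).
  by rewrite -(perm_mem FG).
by move=> a b; rewrite -!(perm_mem FG) => aF bF; apply: Fp.
Qed.

Lemma row_free_cast (K : fieldType) (V : vectType K) (M : 'M[symdual V]_(\dim {:V}))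
    x r (rn : r = \dim {:V}) : map_mx (evalv x) M \in unitmx ->
  row_free (evmx x (fun i : 'I_r => row (cast_ord rn i) M)).
Proof.
move: (rn); rewrite rn => rn' Mu; rewrite row_free_unit.
rewrite (_ : evmx _ _ = map_mx (evalv x) M) //.
by apply/matrixP => i j; rewrite !mxE cast_ord_id.
Qed.

(** * From a separating functional to heights *)

Section HeightFunctional.
Variables (R : realType) (V : vectType R).
Local Notation form := ('Hom(V, R^o)).
Variable dot : form -> form -> R.
Hypothesis dotC : forall x y, dot x y = dot y x.
Hypothesis dotP : forall (t : R) x y z, dot (t *: x + y) z = t * dot x z + dot y z.
Hypothesis dot_gt0 : forall x, x != 0 -> 0 < dot x x.
Variables (Phi : {fset form}) (h0 : form -> R).
Hypotheses (PhiR : rootset dot Phi) (hl0 : functional h0).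
Hypothesis h0n0 : {in Phi, forall a, h0 a != 0}.

Definition height a := twice_height dot Phi h0 a / 2.

Lemma height_functional : functional height.
Proof. by move=> t x y; rewrite /height (twice_height_functional dotP); field. Qed.

Lemma height_pos a : a \in Phi -> 0 < h0 a -> 0 < height a.
Proof.
move=> aP ha; have [m e] := twice_height_nat dotC dotP dot_gt0 PhiR hl0 h0n0 aP ha.
by rewrite /height e divr_gt0 // mulr_gt0 // ltr0n.
Qed.

Lemma height_gt0 a : a \in Phi -> (0 < height a) = (0 < h0 a).
Proof.
move=> aP; have [ha|ha] := ltP 0 (h0 a); first exact: height_pos.
apply/negbTE; rewrite -leNgt -oppr_ge0 -(functionalN _ height_functional) ltW //.
apply: height_pos; first exact: (root_opp dot_gt0 PhiR).
by rewrite functionalN // oppr_gt0 lt_neqAle ha h0n0.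
Qed.

Lemma height_neq0 : {in Phi, forall a, height a != 0}.
Proof.
move=> a aP; have [ha|] := ltP 0 (h0 a); first by rewrite gt_eqF // height_pos.
rewrite le_eqVlt (negPf (h0n0 aP)) /= -oppr_gt0 -functionalN // => ha.
have := height_pos (root_opp dot_gt0 PhiR aP) ha.
by rewrite (functionalN _ height_functional) oppr_gt0 => /lt_eqF ->.
Qed.

(** [height] and [h0] are positive on the same roots, so they select the same coroots. *)
Lemma twice_heightE x : twice_height dot Phi height x = 2 * height x.
Proof.
rewrite /height mulrCA divff ?pnatr_eq0 // mulr1 /twice_height.
rewrite big_seq_cond [RHS]big_seq_cond; apply: eq_bigl => a.
by have [aP|//] := boolP (a \in Phi); rewrite /= height_gt0.
Qed.

End HeightFunctional.

(** The difference to [theta] is a natural combination of positive roots; if its height is 0, every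
    coefficient is 0. *)
Lemma highest_root_height (R : realType) (V : vectType R)
    (Phi Phip : {fset 'Hom(V, R^o)}) (h : 'Hom(V, R^o) -> R) theta :
  functional h -> {in Phip, forall a, 0 < h a} -> highest_root Phi Phip theta ->
  {in Phi, forall a, h a <= h theta /\ (h a = h theta -> a = theta)}.
Proof.
move=> hl hp [_ top] a aP; have [c cE] := top a aP.
have hc : h theta - h a = \sum_(g <- Phip) h g *+ c g.
  rewrite -functionalB // cE functional_sum //; apply: eq_bigr => g _.
  by rewrite -scaler_nat functionalZ // mulr_natl.
have c0 : forall g, g \in Phip -> 0 <= h g *+ c g.
  by move=> g /hp hg; rewrite mulrn_wge0 // ltW.
split; first by rewrite -subr_ge0 hc big_seq; apply: sumr_ge0 => g; apply: c0.
move=> haE; rewrite haE subrr in hc.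
apply/esym/eqP; rewrite -subr_eq0 cE big_seq big1 // => g gP.
have /eqP := esym hc; rewrite big_seq psumr_eq0 // => /allP/(_ g gP).
rewrite gP mulrn_eq0 (gt_eqF (hp g gP)) orbF => /eqP ->; exact: mulr0n.
Qed.

Theorem highest_root_restriction (R : realType) (V : vectType R)
    (Phi Phip : {fset 'Hom(V, R^o)}) (theta : 'Hom(V, R^o)) (e : seq nat) :
  root_system Phi -> crystallographic Phi -> reduced Phi ->
  positive_system Phi Phip -> highest_root Phi Phip theta ->
  size e = \dim {:V} -> exponents (weyl_arrangement Phip) e ->
  exponents (restriction (weyl_arrangement Phip) (lker theta))
    (take (size e).-1 e).
Proof.
move=> PhiS Phic Phir [v0 [v0n0 PhipE]] tht en [es [phi [phiB phie]]].
pose dot := root_dot Phi.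
have dotC := root_dotC PhiS.
have dotP := @root_dotP R V Phi.
have dot_gt0 := root_dot_gt0 PhiS.
have PhiR := root_system_rootset PhiS Phic Phir.
pose h0 (a : 'Hom(V, R^o)) : R := a v0.
have hl0 : functional h0 by move=> t x y; rewrite /h0 add_lfunE scale_lfunE.
have h0n0 : {in Phi, forall a, h0 a != 0} by move=> a aP; apply: v0n0.
pose h := height dot Phi h0.
have hl : functional h := height_functional dotP Phi h0.
have hn0 : {in Phi, forall a, h a != 0} := height_neq0 dotC dotP dot_gt0 PhiR hl0 h0n0.
have hE : forall x, twice_height dot Phi h x = 2 * h x :=
  twice_heightE dotC dotP dot_gt0 PhiR hl0 h0n0.
have h_gt0 a : a \in Phi -> (0 < h a) = (0 < h0 a) :=
  @height_gt0 _ _ _ dotC dotP dot_gt0 _ _ PhiR hl0 h0n0 a.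
have PhipP a : (a \in Phip) = (a \in Phi) && (0 < h a).
  rewrite PhipE !inE /=; have [aP|//] := boolP (a \in Phi).
  by rewrite h_gt0.
have [thP _] := tht.
have top := highest_root_height hl _ tht.
have {}top : {in Phi, forall a, h a <= h theta /\ (h a = h theta -> a = theta)}.
  by apply: top => a; rewrite PhipP => /andP[].
have hth0 : 0 < h theta.
  have [+ _] := top _ (root_opp dot_gt0 PhiR thP).
  by rewrite functionalN // => hth; rewrite lt_neqAle eq_sym hn0 //=; lra.
have [m hth] := height_nat dotC dotP dot_gt0 PhiR hl hn0 hE thP hth0.
have [d [M [i0 [x [ML Mth [thx Mu] [dm di0 dA] [cm [M' [ML' dF Mn0']]]]]]]] :=
  top_step dotC dotP dot_gt0 PhiR hl hn0 hE thP hth.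
set F := below Phi h m ++ [:: theta] in ML' dF.
have FP : perm_eq [seq a <- Phi | 0 < h a] F.
  apply: uniq_perm => [||a].
  - by rewrite filter_uniq ?fset_uniq.
  - rewrite cat_uniq filter_uniq ?fset_uniq //= orbF andbT.
    by rewrite mem_filter hth ltxx andbF.
  rewrite mem_cat !mem_filter inE -hth.
  have [->|ath] := eqVneq a theta; first by rewrite hth0 thP orbT.
  rewrite orbF; have [aP|] := boolP (a \in Phi); last by rewrite !andbF.
  have [le_top eq_top] := top a aP.
  have -> : h a < h theta by rewrite lt_neqAle le_top andbT (contra_neq eq_top ath).
  by rewrite !andbT.
have Fn : nonparallel F.
  by apply: nonparallel_perm FP _; apply: (positive_nonparallel PhiR hl).
have FE a : (a \in F) = (a \in Phip) by rewrite -(perm_mem FP) mem_filter PhipP andbC.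
have AP X : X \in weyl_arrangement Phip <-> exists2 a, a \in F & X = lker a.
  split=> [/imfsetP[a /= aP ->]|[a aF ->]]; first by exists a; rewrite ?FE.
  by apply/imfsetP; exists a; rewrite //= -FE.
have AF : represents (weyl_arrangement Phip) F.
  split=> [X /AP[a aF ->]|a aF]; first by exists a.
  by apply/AP; exists a.
have F0 : {in F, forall a : 'Hom(V, R^o), a v0 != 0}.
  by move=> a; rewrite FE PhipP => /andP[aP _]; apply: v0n0.
have Mu' := saito_unit Fn ML' dF Mn0' F0.
pose d' i := (d i + (i == i0))%N.
have [ML1 ML2] := ML'.
have sum_d' : (\sum_(i < size e) d' (cast_ord en i))%N = size F.
  rewrite -dF; symmetry; rewrite (reindex (cast_ord en)) //=.
  by exists (cast_ord (esym en)) => i _; rewrite ?cast_ordK ?cast_ordKV.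
have ML2c (i : 'I_(size e)) j : row (cast_ord en i) M' 0 j \is (d' (cast_ord en i)).-homog.
  by rewrite mxE; apply: ML2.
have [s sI sE] := exponents_unique AF Fn en (fun i => ML1 (cast_ord en i))
  ML2c sum_d' (row_free_cast en Mu') phiB phie.
(* [t] sends a position in [e] to a row of [M'] with that degree. *)
pose t i := cast_ord en (s i).
have tI : injective t by move=> i j /cast_ord_inj/sI.
have th0 : theta != 0 by have [P0 _ _ _] := PhiR; apply: contraNneq P0 => <-.
have dimW := dim_lker th0.
set r := (size e).-1.
have se : size e = r.+1 by rewrite /r en -dimW.
pose L : 'I_(size e) := cast_ord (esym se) ord_max.
have d'le i : i != i0 -> d' i = d i by rewrite /d' => /negPf ->; rewrite addn0.
(* [i0] is the only row of degree [m.+1], all others having degree at most [m]; as [e] is sorted,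
   its last position must be matched with [i0]. *)
have tL : t L = i0.
  have [g sg gs] := injF_bij sI.
  pose i := g (cast_ord (esym en) i0).
  have ti : t i = i0 by rewrite /t /i gs cast_ordKV.
  apply/eqP/negPn/negP => tLi0.
  have : (nth 0%N e i <= nth 0%N e L)%N.
    apply: (sorted_leq_nth leq_trans leqnn 0%N es); rewrite ?inE ?ltn_ord //.
    by rewrite -ltnS -[X in (_ < X)%N]se ltn_ord.
  rewrite !sE -/(t i) -/(t L) ti (d'le _ tLi0) /d' eqxx di0 addn1.
  by rewrite ltnNge dm.
have sz : size (take r e) = r by rewrite size_takel // se.
have le_r : (size (take r e) <= size e)%N by rewrite sz se.
pose k j := t (widen_ord le_r j).
have kI : injective k.
  by move=> i j /tI/(congr1 val) /= ij; apply: val_inj.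
have ki0 j : k j != i0.
  rewrite -tL; apply/eqP => /tI/(congr1 val) /= jr.
  by have := ltn_ord j; rewrite jr sz ltnn.
have ek (j : 'I_(size (take r e))) : nth 0%N (take r e) j = d (k j).
  have jr : (j < r)%N by rewrite -[X in (_ < X)%N]sz.
  by rewrite nth_take // -(d'le _ (ki0 j)) (sE (widen_ord le_r j)).
(* The whole of [e] sums to [size (res_forms Phi h theta m) + m + 1], and the dropped last entry is
   [m.+1]. *)
have sum_r : (\sum_j d (k j))%N = size (res_forms Phi h theta m).
  have := size_res_forms cm; rewrite -dA => szr.
  have : (\sum_(x <- e) x)%N = (\sum_i d' i)%N.
    rewrite (big_nth 0%N) big_mkord.
    transitivity (\sum_(i < size e) d' (t i))%N; first by apply: eq_bigr.
    rewrite dF -sum_d'; symmetry.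
    by rewrite (reindex_inj sI).
  rewrite /d' big_split /= -szr -[in LHS](cat_take_drop r e) big_cat /=.
  rewrite (drop_nth 0%N) ?se // drop_oversize ?se // big_seq1.
  have -> : nth 0%N e r = m.+1.
    have := sE L; rewrite -/(t L) tL /d' eqxx di0 addn1 => <-.
    by congr nth.
  have -> : (\sum_(i < \dim {:V}) (i == i0))%N = 1%N.
    by rewrite (bigD1 i0) //= eqxx big1 // => i /negPf ->.
  rewrite (big_nth 0%N) big_mkord addn1 addnS => -[/addIn <-].
  by apply: eq_bigr => j _; rewrite ek.
split; first exact: take_sorted.
exists (fun j => der (res_vf theta (row (k j) M))); split.
  apply: (saito_log_basis (res_represents PhiR hl thP hth _) (res_nonparallel PhiR hl thP hth)
    (d := d \o k) _ _ _ sum_r (res_row_free kI thx Mu _)).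
  - exact: AP.
  - by rewrite sz /r en -dimW.
  - move=> j _ /mapP[a + ->]; rewrite mem_filter => /andP[_ al].
    rewrite vf_res_tangent; last exact: Mth.
    have [ML3 _] := ML; have [g ->] := ML3 (k j) a al.
    by rewrite rmorphM /= pullback_form; exists (pullback (incl theta) g).
  - by move=> j; apply: res_vf_homog => i; rewrite mxE; have [_ ->] := ML.
  - by move=> j; apply: Mth.
move=> j i; rewrite derX ek; apply: res_vf_homog => l.
by rewrite mxE; have [_ ->] := ML.
Qed.

Theorem corollary1p4 (R : realType) (l : nat)
    (Phi Phip : {fset 'Hom('rV[R]_l, R^o)}) (theta : 'Hom('rV[R]_l, R^o))
    (e : l.-tuple nat) :
  root_system Phi -> crystallographic Phi -> reduced Phi -> irreducible Phi ->
  positive_system Phi Phip -> highest_root Phi Phip theta ->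
  exponents (weyl_arrangement Phip) e ->
  free_arrangement (restriction (weyl_arrangement Phip) (lker theta)) /\
  exponents (restriction (weyl_arrangement Phip) (lker theta)) (take l.-1 e).
Proof.
move=> PhiS Phic Phir _ Phip_pos tht ee.
have en : size e = \dim {:'rV[R]_l} by rewrite size_tuple dimvf /dim /= mul1n.
have := highest_root_restriction PhiS Phic Phir Phip_pos tht en ee.
rewrite size_tuple => ex; split=> //.
by have [_ [th [thB _]]] := ex; exists (size (take l.-1 e)), th.
Qed.
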